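(* Let $\mathcal{C}$ be a triangulated category with suspension $\Sigma$, and let $\xi$ be a proper class of triangles in $\mathcal{C}$ which is closed under suspension, such that $\mathcal{C}$ has enough $\xi$-projectives and enough $\xi$-injectives. Assume that $\mathcal{P}(\xi)$ is a generating subcategory of $\mathcal{C}$ and $\mathcal{I}(\xi)$ is a cogenerating subcategory of $\mathcal{C}$. Then the following are equivalent for any non-negative integer $m$: (1) $\sup\{\xi\text{-}\mathcal{G}\mathrm{pd}\,M\mid M\in\mathcal{C}\}\leq m$; (2) $\sup\{\xi\text{-}\mathcal{G}\mathrm{id}\,M\mid M\in\mathcal{C}\}\leq m$; (3) $\xi\text{-}\mathrm{spli}\,\mathcal{C}=\xi\text{-}\mathrm{silp}\,\mathcal{C}\leq m$. Moreover, $$\sup\{\xi\text{-}\mathcal{G}\mathrm{pd}\,M\mid M\in\mathcal{C}\}=\sup\{\xi\text{-}\mathcal{G}\mathrm{id}\,M\mid M\in\mathcal{C}\}.$$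
   Context: **Proper classes of triangles.** ''Triangle'' means distinguished triangle $A\xrightarrow{x}B\xrightarrow{y}C\xrightarrow{\delta}\Sigma A$; it is split if $\delta=0$. A class $\xi$ of triangles closed under isomorphisms is proper if: (a) it is closed under finite coproducts and contains all split triangles; (b) it is closed under base change (for $c:C'\to C$, any triangle $A\to B'\to C'\xrightarrow{\delta c}\Sigma A$ is in $\xi$ whenever $A\to B\to C\xrightarrow{\delta}\Sigma A$ is) and cobase change (for $a:A\to A'$, any triangle $A'\to B'\to C\xrightarrow{(\Sigma a)\delta}\Sigma A'$ is in $\xi$ whenever $A\to B\to C\xrightarrow{\delta}\Sigma A$ is); (c) it is saturated: given triangles $A_1\xrightarrow{x_1}B_1\xrightarrow{y_1}C\xrightarrow{\delta_1}\Sigma A_1$ and $A_2\xrightarrow{x_2}B_2\xrightarrow{y_2}C\xrightarrow{\delta_2}\Sigma A_2$, if the second triangle and the triangle $A_1\to M\to B_2\xrightarrow{\delta_1y_2}\Sigma A_1$ are in $\xi$, then so is the first triangle. It is closed under suspension if for every $A\xrightarrow{x}B\xrightarrow{y}C\xrightarrow{\delta}\Sigma A$ in $\xi$ and every $i\in\mathbb{Z}$ the triangle $\Sigma^iA\xrightarrow{(-1)^i\Sigma^ix}\Sigma^iB\xrightarrow{(-1)^i\Sigma^iy}\Sigma^iC\xrightarrow{(-1)^i\Sigma^i\delta}\Sigma^{i+1}A$ is in $\xi$. **Projectives and injectives.** $P$ is $\xi$-projective if for every triangle $A\to B\to C\to\Sigma A$ in $\xi$ the sequence $0\to\mathcal{C}(P,A)\to\mathcal{C}(P,B)\to\mathcal{C}(P,C)\to0$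 is exact; $\xi$-injective is dual. $\mathcal{P}(\xi)$, $\mathcal{I}(\xi)$ are the full subcategories of $\xi$-projectives and $\xi$-injectives. Enough $\xi$-projectives (resp. $\xi$-injectives): every $A$ admits a triangle $K\to P\to A\to\Sigma K$ (resp. $A\to I\to K\to\Sigma A$) in $\xi$ with $P\in\mathcal{P}(\xi)$ (resp. $I\in\mathcal{I}(\xi)$). **Dimensions.** $\xi\text{-}\mathrm{pd}\,A=0$ iff $A\in\mathcal{P}(\xi)$; inductively $\xi\text{-}\mathrm{pd}\,A\le n$ if there is a triangle $K\to P\to A\to\Sigma K$ in $\xi$ with $P\in\mathcal{P}(\xi)$ and $\xi\text{-}\mathrm{pd}\,K\le n-1$; the dimension is the least such $n$, or $\infty$. $\xi\text{-}\mathrm{id}$ is dual. Put $\xi\text{-}\mathrm{silp}\,\mathcal{C}=\sup\{\xi\text{-}\mathrm{id}\,P\mid P\in\mathcal{P}(\xi)\}$ and $\xi\text{-}\mathrm{spli}\,\mathcal{C}=\sup\{\xi\text{-}\mathrm{pd}\,I\mid I\in\mathcal{I}(\xi)\}$. **$\xi$-$\mathcal{G}$projectives and $\xi$-$\mathcal{G}$injectives.** A triangle $A\to B\to C\to\Sigma A$ in $\xi$ is $\mathcal{C}(-,\mathcal{W})$-exact if $0\to\mathcal{C}(C,W)\to\mathcal{C}(B,W)\to\mathcal{C}(A,W)\to0$ is exact for all $W\in\mathcal{W}$, and $\mathcal{C}(\mathcal{W},-)$-exact if $0\to\mathcal{C}(W,A)\to\mathcal{C}(W,B)\to\mathcal{C}(W,C)\to0$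 is exact for all $W\in\mathcal{W}$. A complete $\xi$-projective resolution is a complex $\cdots\to P_1\to P_0\to P_{-1}\to\cdots$ with all $P_n\in\mathcal{P}(\xi)$ together with, for each $n\in\mathbb{Z}$, a $\mathcal{C}(-,\mathcal{P}(\xi))$-exact triangle $K_{n+1}\xrightarrow{g_n}P_n\xrightarrow{f_n}K_n\to\Sigma K_{n+1}$ in $\xi$, with differential $d_n=g_{n-1}f_n$. The objects $K_n$ so arising are the $\xi$-$\mathcal{G}$projective objects, forming $\mathcal{GP}(\xi)$. Dually, a complete $\xi$-injective coresolution has all terms $I_n\in\mathcal{I}(\xi)$ and $\mathcal{C}(\mathcal{I}(\xi),-)$-exact triangles $K_{n+1}\to I_n\to K_n\to\Sigma K_{n+1}$ in $\xi$; the $K_n$ are the $\xi$-$\mathcal{G}$injective objects, forming $\mathcal{GI}(\xi)$. The dimensions $\xi\text{-}\mathcal{G}\mathrm{pd}$ and $\xi\text{-}\mathcal{G}\mathrm{id}$ are defined inductively as $\xi\text{-}\mathrm{pd}$ and $\xi\text{-}\mathrm{id}$ with $\mathcal{GP}(\xi)$, $\mathcal{GI}(\xi)$ in place of $\mathcal{P}(\xi)$, $\mathcal{I}(\xi)$. **Generating.** A full subcategory $\mathcal{X}$ of $\mathcal{C}$ is generating if for all $A\in\mathcal{C}$, $\mathcal{C}(X,A)=0$ for all $X\in\mathcal{X}$ implies $A=0$. A full subcategory $\mathcal{Y}$ is cogenerating if for all $B\in\mathcal{C}$, $\mathcal{C}(B,Y)=0$ for all $Y\in\mathcal{Y}$ implies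 $B=0$. *)

(* Defs.v *)
From mathcomp Require Import all_boot all_order all_algebra.
From mathcomp Require Import boolp.
Set Implicit Arguments.
Unset Strict Implicit.
Unset Printing Implicit Defensive.
Import GRing.Theory.
Local Open Scope ring_scope.

(** * Additive categories *)

Record preaddCat := PreaddCat {
  obj :> Type;
  hom : obj -> obj -> zmodType;
  idm : forall A, hom A A;
  comp : forall A B C, hom B C -> hom A B -> hom A C;
  comp1m : forall A B (f : hom A B), comp (idm B) f = f;
  compm1 : forall A B (f : hom A B), comp f (idm A) = f;
  compA : forall A B C D (h : hom C D) (g : hom B C) (f : hom A B),
    comp h (comp g f) = comp (comp h g) f;
  compDl : forall A B C (g g' : hom B C) (f : hom A B),
    comp (g + g') f = comp g f + comp g' f;
  compDr : forall A B C (g : hom B C) (f f' : hom A B),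
    comp g (f + f') = comp g f + comp g f' }.

Arguments hom {p} A B.
Arguments idm {p} A.
Arguments comp {p A B C} g f.

(* [g \oc f] is "g after f". *)
Notation "g \oc f" := (comp g f) (at level 50, left associativity).

Definition is_iso (C : preaddCat) (A B : C) (f : hom A B) : Prop :=
  exists g : hom B A, g \oc f = idm A /\ f \oc g = idm B.

Definition is_zero (C : preaddCat) (Z : C) : Prop :=
  forall X : C, (forall f : hom Z X, f = 0) /\ (forall f : hom X Z, f = 0).

Definition is_coprod (C : preaddCat) (I : finType) (A : I -> C) (S : C)
    (inj : forall i, hom (A i) S) : Prop :=
  forall (T : C) (f : forall i, hom (A i) T),
    exists! h : hom S T, forall i, h \oc inj i = f i.

(* A preadditive category with finite coproducts is additive: the coproduct of
   the empty family is a zero object and binary coproducts are biproducts. *)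
Record addCat := AddCat {
  addCat_base :> preaddCat;
  has_coprod : forall (I : finType) (A : I -> addCat_base),
    exists S inj, @is_coprod addCat_base I A S inj }.

Record addFunctor (C D : preaddCat) := AddFunctor {
  fobj :> C -> D;
  fmap : forall A B, hom A B -> hom (fobj A) (fobj B);
  fmap1 : forall A, fmap (idm A) = idm (fobj A);
  fmapM : forall A B E (g : hom B E) (f : hom A B),
    fmap (g \oc f) = fmap g \oc fmap f;
  fmapD : forall A B (f f' : hom A B), fmap (f + f') = fmap f + fmap f' }.

Arguments fmap {C D} F {A B} f : rename.

(** * Additive categories with a suspension *)

(* The suspension is an autoequivalence; it comes with a quasi-inverse [desusp]
   organised into an adjoint equivalence (unit [su], counit [sv]).  The strict
   case, where the suspension is an automorphism, is su = id and sv = id. *)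
Record suspCat := SuspCat {
  suspCat_base :> addCat;
  susp : addFunctor suspCat_base suspCat_base;
  desusp : addFunctor suspCat_base suspCat_base;
  su : forall A : suspCat_base, hom A (susp (desusp A));
  sv : forall A : suspCat_base, hom (desusp (susp A)) A;
  su_nat : forall (A B : suspCat_base) (f : hom A B),
    su B \oc f = fmap susp (fmap desusp f) \oc su A;
  sv_nat : forall (A B : suspCat_base) (f : hom A B),
    sv B \oc fmap desusp (fmap susp f) = f \oc sv A;
  su_iso : forall A, is_iso (su A);
  sv_iso : forall A, is_iso (sv A);
  su_sv_desusp : forall A, sv (desusp A) \oc fmap desusp (su A) = idm (desusp A);
  su_sv_susp : forall A, fmap susp (sv A) \oc su (susp A) = idm (susp A) }.

Arguments susp {s}.
Arguments desusp {s}.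
Arguments su {s} A.
Arguments sv {s} A.

Notation "''S' A" := (susp A) (at level 8, A at level 2, format "''S'  A").
Notation "''Sm' f" := (fmap susp f) (at level 8, f at level 2, format "''Sm'  f").

Section SuspPower.
Variable C : suspCat.

Fixpoint iobj (F : addFunctor C C) (n : nat) (A : C) : C :=
  if n is n'.+1 then F (iobj F n' A) else A.

Fixpoint imap (F : addFunctor C C) (n : nat) (A B : C) (f : hom A B) :
    hom (iobj F n A) (iobj F n B) :=
  match n with 0%N => f | n'.+1 => fmap F (imap F n' f) end.

Definition spow (i : int) (A : C) : C :=
  match i with Posz n => iobj susp n A | Negz n => iobj desusp n.+1 A end.

Definition spmap (i : int) (A B : C) (f : hom A B) : hom (spow i A) (spow i B) :=
  match i with Posz n => imap susp n f | Negz n => imap desusp n.+1 f end.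

Fixpoint swap_susp (n : nat) (A : C) : hom (iobj susp n ('S A)) ('S (iobj susp n A)) :=
  match n with 0%N => idm _ | n'.+1 => 'Sm (swap_susp n' A) end.

Fixpoint swap_desusp (n : nat) (A : C) :
    hom (iobj desusp n ('S A)) ('S (iobj desusp n A)) :=
  match n with
  | 0%N => idm _
  | n'.+1 => su _ \oc sv _ \oc fmap desusp (swap_desusp n' A)
  end.

(* The canonical isomorphism from [Sigma^i (Sigma A)] to [Sigma (Sigma^i A)];
   it identifies both objects with [Sigma^(i+1) A]. *)
Definition spswap (i : int) (A : C) : hom (spow i ('S A)) ('S (spow i A)) :=
  match i with Posz n => swap_susp n A | Negz n => swap_desusp n.+1 A end.

End SuspPower.

(** * Triangulated categories *)

(* A diagram A -> B -> C -> Sigma A, not assumed to be distinguished. *)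
Record triangle (C : suspCat) := Triangle {
  tA : C; tB : C; tC : C;
  tx : hom tA tB;
  ty : hom tB tC;
  td : hom tC ('S tA) }.

Arguments Triangle {C tA tB tC} tx ty td.

Definition triangle_iso (C : suspCat) (T T' : triangle C) : Prop :=
  exists (a : hom (tA T) (tA T')) (b : hom (tB T) (tB T')) (c : hom (tC T) (tC T')),
    [/\ is_iso a, is_iso b & is_iso c] /\
    [/\ b \oc tx T = tx T' \oc a, c \oc ty T = ty T' \oc b
      & 'Sm a \oc td T = td T' \oc c].

Record triangCat := TriangCat {
  triangCat_base :> suspCat;
  dist : triangle triangCat_base -> Prop;
  dist_iso : forall T T', dist T -> triangle_iso T T' -> dist T';
  dist_id : forall A Z : triangCat_base,
    is_zero Z -> dist (Triangle (idm A) (0 : hom A Z) 0);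
  dist_cone : forall (A B : triangCat_base) (x : hom A B),
    exists (C : triangCat_base) (y : hom B C) (d : hom C ('S A)),
      dist (Triangle x y d);
  dist_rot : forall (A B C : triangCat_base)
      (x : hom A B) (y : hom B C) (d : hom C ('S A)),
    dist (Triangle x y d) <-> dist (Triangle y d (- 'Sm x));
  dist_fill : forall (A B C A' B' C' : triangCat_base)
      (x : hom A B) (y : hom B C) (d : hom C ('S A))
      (x' : hom A' B') (y' : hom B' C') (d' : hom C' ('S A'))
      (a : hom A A') (b : hom B B'),
    dist (Triangle x y d) -> dist (Triangle x' y' d') -> b \oc x = x' \oc a ->
    exists c : hom C C', c \oc y = y' \oc b /\ 'Sm a \oc d = d' \oc c;
  dist_octa : forall (X Y Z X' Y' Z' : triangCat_base)
      (f : hom X Y) (i : hom Y Z') (j : hom Z' ('S X))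
      (g : hom Y Z) (k : hom Z X') (l : hom X' ('S Y))
      (m : hom Z Y') (n : hom Y' ('S X)),
    dist (Triangle f i j) -> dist (Triangle g k l) -> dist (Triangle (g \oc f) m n) ->
    exists (u : hom Z' Y') (v : hom Y' X'),
      dist (Triangle u v ('Sm i \oc l)) /\
      [/\ u \oc i = m \oc g, n \oc u = j, v \oc m = k & l \oc v = 'Sm f \oc n] }.

Arguments dist {t} T.

(** * Proper classes of triangles *)

Section ProperClass.
Variables (C : triangCat) (xi : triangle C -> Prop).

(* [T] is the coproduct of the finite family of diagrams [F]: its vertices are
   coproducts of the vertices and its maps are the induced ones. *)
Definition is_triangle_coprod (I : finType) (F : I -> triangle C) (T : triangle C) : Prop :=
  exists (a : forall i, hom (tA (F i)) (tA T))
         (b : forall i, hom (tB (F i)) (tB T))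
         (c : forall i, hom (tC (F i)) (tC T)),
    [/\ is_coprod a, is_coprod b & is_coprod c] /\
    forall i, [/\ tx T \oc a i = b i \oc tx (F i),
                  ty T \oc b i = c i \oc ty (F i)
                & td T \oc c i = 'Sm (a i) \oc td (F i)].

Definition closed_coprod : Prop :=
  forall (I : finType) (F : I -> triangle C) (T : triangle C),
    (forall i, xi (F i)) -> is_triangle_coprod F T -> xi T.

Definition contains_split : Prop :=
  forall (A B D : C) (x : hom A B) (y : hom B D),
    dist (Triangle x y 0) -> xi (Triangle x y 0).

Definition closed_base_change : Prop :=
  forall (A B D : C) (x : hom A B) (y : hom B D) (d : hom D ('S A))
      (B' D' : C) (c : hom D' D) (x' : hom A B') (y' : hom B' D'),
    xi (Triangle x y d) -> dist (Triangle x' y' (d \oc c)) ->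
    xi (Triangle x' y' (d \oc c)).

Definition closed_cobase_change : Prop :=
  forall (A B D : C) (x : hom A B) (y : hom B D) (d : hom D ('S A))
      (A' B' : C) (a : hom A A') (x' : hom A' B') (y' : hom B' D),
    xi (Triangle x y d) -> dist (Triangle x' y' ('Sm a \oc d)) ->
    xi (Triangle x' y' ('Sm a \oc d)).

Definition saturated : Prop :=
  forall (A1 B1 A2 B2 D M : C)
      (x1 : hom A1 B1) (y1 : hom B1 D) (d1 : hom D ('S A1))
      (x2 : hom A2 B2) (y2 : hom B2 D) (d2 : hom D ('S A2))
      (x : hom A1 M) (y : hom M B2),
    dist (Triangle x1 y1 d1) ->
    xi (Triangle x2 y2 d2) -> xi (Triangle x y (d1 \oc y2)) ->
    xi (Triangle x1 y1 d1).

Record proper_class : Prop := ProperClass {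
  proper_dist : forall T, xi T -> dist T;
  proper_iso : forall T T', xi T -> triangle_iso T T' -> xi T';
  proper_coprod : closed_coprod;
  proper_split : contains_split;
  proper_base : closed_base_change;
  proper_cobase : closed_cobase_change;
  proper_saturated : saturated }.

Definition triangle_susp (i : int) (T : triangle C) : triangle C :=
  Triangle (spmap i (tx T) *~ ((-1) ^ i))
           (spmap i (ty T) *~ ((-1) ^ i))
           ((spswap i (tA T) \oc spmap i (td T)) *~ ((-1) ^ i)).

Definition closed_susp : Prop :=
  forall (i : int) (T : triangle C), xi T -> xi (triangle_susp i T).

End ProperClass.

(** * Projectives and injectives *)

Definition short_exact (U V W : zmodType) (f : U -> V) (g : V -> W) : Prop :=
  [/\ injective f, forall v, g v = 0 <-> (exists u, f u = v)
    & forall w, exists v, g v = w].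

Definition hom_from_exact (C : triangCat) (P : C) (T : triangle C) : Prop :=
  short_exact (fun f : hom P (tA T) => tx T \oc f)
              (fun f : hom P (tB T) => ty T \oc f).

Definition hom_to_exact (C : triangCat) (T : triangle C) (J : C) : Prop :=
  short_exact (fun f : hom (tC T) J => f \oc ty T)
              (fun f : hom (tB T) J => f \oc tx T).

Section Homological.
Variables (C : triangCat) (xi : triangle C -> Prop).

Definition xi_proj (P : C) : Prop := forall T, xi T -> hom_from_exact P T.
Definition xi_inj (J : C) : Prop := forall T, xi T -> hom_to_exact T J.

Definition enough_proj : Prop :=
  forall A : C, exists (K P : C) (x : hom K P) (y : hom P A) (d : hom A ('S K)),
    xi_proj P /\ xi (Triangle x y d).

Definition enough_inj : Prop :=
  forall A : C, exists (J K : C) (x : hom A J) (y : hom J K) (d : hom K ('S A)),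
    xi_inj J /\ xi (Triangle x y d).

(** ** Gorenstein projectives and injectives *)

(* A complex with terms [cP n] in [X], glued from triangles in [xi] satisfying
   the exactness condition [E].  The differential d_n = g_(n-1) f_n is indexed
   with the shift n |-> n+1, which avoids casting along (n - 1) + 1 = n; that
   d^2 = 0 is automatic, since f_n g_n = 0 in a triangle. *)
Record complete_resolution (X : C -> Prop) (E : triangle C -> Prop) := CompleteRes {
  cP : int -> C;
  cK : int -> C;
  cg : forall n : int, hom (cK (n + 1)) (cP n);
  cf : forall n : int, hom (cP n) (cK n);
  ch : forall n : int, hom (cK n) ('S (cK (n + 1)));
  cd : forall n : int, hom (cP (n + 1)) (cP n);
  cP_in : forall n, X (cP n);
  c_xi : forall n, xi (Triangle (cg n) (cf n) (ch n));
  c_exact : forall n, E (Triangle (cg n) (cf n) (ch n));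
  cdE : forall n, cd n = cg n \oc cf (n + 1) }.

Definition xi_Gproj (A : C) : Prop :=
  exists (R : complete_resolution xi_proj
                (fun T => forall W, xi_proj W -> hom_to_exact T W)) (n : int),
    A = cK R n.

Definition xi_Ginj (A : C) : Prop :=
  exists (R : complete_resolution xi_inj
                (fun T => forall W, xi_inj W -> hom_from_exact W T)) (n : int),
    A = cK R n.

(** ** Dimensions *)

Fixpoint resdim_le (X : C -> Prop) (n : nat) (A : C) : Prop :=
  match n with
  | 0%N => X A
  | n'.+1 => exists (K P : C) (x : hom K P) (y : hom P A) (d : hom A ('S K)),
      [/\ xi (Triangle x y d), X P & resdim_le X n' K]
  end.

Fixpoint coresdim_le (Y : C -> Prop) (n : nat) (A : C) : Prop :=
  match n with
  | 0%N => Y A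
  | n'.+1 => exists (J K : C) (x : hom A J) (y : hom J K) (d : hom K ('S A)),
      [/\ xi (Triangle x y d), Y J & coresdim_le Y n' K]
  end.

End Homological.

(* Extended naturals; [None] is infinity. *)
Definition enat := option nat.

Definition enat_le (u v : enat) : bool :=
  match u, v with
  | _, None => true
  | None, Some _ => false
  | Some a, Some b => (a <= b)%N
  end.

(* The least natural number satisfying [Q], or infinity if there is none. *)
Definition least (Q : nat -> Prop) : enat :=
  match pselect (exists n, `[< Q n >]) with
  | left exQ => Some (ex_minn exQ)
  | right _ => None
  end.

Definition enat_sup (U : enat -> Prop) : enat :=
  least (fun n => forall u, U u -> enat_le u (Some n)).

Section Dimensions.
Variables (C : triangCat) (xi : triangle C -> Prop).

Definition xi_pd (A : C) : enat := least (fun n => resdim_le xi (xi_proj xi) n A).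
Definition xi_id (A : C) : enat := least (fun n => coresdim_le xi (xi_inj xi) n A).
Definition xi_Gpd (A : C) : enat := least (fun n => resdim_le xi (xi_Gproj xi) n A).
Definition xi_Gid (A : C) : enat := least (fun n => coresdim_le xi (xi_Ginj xi) n A).

Definition xi_silp : enat :=
  enat_sup (fun u => exists P : C, xi_proj xi P /\ u = xi_id P).
Definition xi_spli : enat :=
  enat_sup (fun u => exists J : C, xi_inj xi J /\ u = xi_pd J).

Definition sup_Gpd : enat := enat_sup (fun u => exists M : C, u = xi_Gpd M).
Definition sup_Gid : enat := enat_sup (fun u => exists M : C, u = xi_Gid M).

End Dimensions.

Definition generating (C : triangCat) (X : C -> Prop) : Prop :=
  forall A : C, (forall P, X P -> forall f : hom P A, f = 0) -> is_zero A.

Definition cogenerating (C : triangCat) (Y : C -> Prop) : Prop :=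
  forall B : C, (forall J, Y J -> forall f : hom B J, f = 0) -> is_zero B.

(* Main.v *)
(** Extension classes [d : D -> Sigma A] with [(x, y, d)] in [xi] behave like an
    Ext^1 bifunctor.  If all objects have G-projective dimension at most [m],
    then Ext^(m+1) into a projective vanishes, so projectives have injective
    dimension at most [m]; an injective [J] is a direct summand of its
    Auslander-Buchweitz approximation [J -> H -> G], where [H] has projective
    dimension at most [m].  Conversely, if these two bounds hold, then the
    horseshoe lemma applied to [M -> I -> N] with [I] injective gives a triangle
    on [m]-th syzygies whose middle term is projective, so the [m]-th syzygies
    form a class with complete resolutions.  All of this uses only a self-dual
    list of properties of Ext^1; the injective half is the same argument in the
    opposite category.  When both invariants are finite they agree, since an
    object of finite projective dimension has projective dimension at most the
    bound on injective dimensions of projectives. *)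

From mathcomp Require Import all_boot all_algebra.
From mathcomp Require Import boolp.
Require Import Defs.
Set Implicit Arguments.
Unset Strict Implicit.
Unset Printing Implicit Defensive.
Import GRing.Theory.
Local Open Scope ring_scope.

(** * Gorenstein dimensions in an extension structure *)

Definition is_null (C : preaddCat) (Z : C) : Prop := idm Z = 0.

Section Preadditive.
Variable C : preaddCat.
Implicit Types A B D : C.

Lemma comp0m A B D (f : hom A B) : (0 : hom B D) \oc f = 0.
Proof. by apply: (addrI (0 \oc f)); rewrite -compDl !addr0. Qed.

Lemma compm0 A B D (f : hom B D) : f \oc (0 : hom A B) = 0.
Proof. by apply: (addrI (f \oc 0)); rewrite -compDr !addr0. Qed.

Lemma compNl A B D (g : hom B D) (f : hom A B) : (- g) \oc f = - (g \oc f).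
Proof. by apply: (addrI (g \oc f)); rewrite -compDl !subrr comp0m. Qed.

Lemma compNr A B D (g : hom B D) (f : hom A B) : g \oc (- f) = - (g \oc f).
Proof. by apply: (addrI (g \oc f)); rewrite -compDr !subrr compm0. Qed.

End Preadditive.

(* [ext D A] stands for Hom(D, Sigma A) and [confl x y d] for [(x, y, d)] being
   in [xi]; the fields come in dual pairs, [confl_fill] being self-dual. *)
Record extCat := ExtCat {
  ec_cat :> preaddCat;
  ext : ec_cat -> ec_cat -> zmodType;
  push : forall (A A' D : ec_cat), hom A A' -> ext D A -> ext D A';
  pull : forall (A D D' : ec_cat), ext D A -> hom D' D -> ext D' A;
  push1 : forall (A D : ec_cat) (d : ext D A), push (idm A) d = d;
  pull1 : forall (A D : ec_cat) (d : ext D A), pull d (idm D) = d;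
  pushM : forall (A A' A'' D : ec_cat)
      (a' : hom A' A'') (a : hom A A') (d : ext D A),
    push (a' \oc a) d = push a' (push a d);
  pullM : forall (A D D' D'' : ec_cat)
      (d : ext D A) (c : hom D' D) (c' : hom D'' D'),
    pull d (c \oc c') = pull (pull d c) c';
  push0 : forall (A A' D : ec_cat) (d : ext D A), push (0 : hom A A') d = 0;
  pull0 : forall (A D D' : ec_cat) (d : ext D A), pull d (0 : hom D' D) = 0;
  pushr0 : forall (A A' D : ec_cat) (a : hom A A'), push a (0 : ext D A) = 0;
  pulll0 : forall (A D D' : ec_cat) (c : hom D' D), pull (0 : ext D A) c = 0;
  confl : forall (A B D : ec_cat), hom A B -> hom B D -> ext D A -> Prop;
  confl_comp : forall (A B D : ec_cat) (x : hom A B) (y : hom B D) d,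
    confl x y d -> y \oc x = 0;
  confl_pull : forall (A B D : ec_cat) (x : hom A B) (y : hom B D) d,
    confl x y d -> pull d y = 0;
  confl_push : forall (A B D : ec_cat) (x : hom A B) (y : hom B D) d,
    confl x y d -> push x d = 0;
  confl_ker : forall (A B D : ec_cat) (x : hom A B) (y : hom B D) d,
    confl x y d ->
    forall (W : ec_cat) (g : hom W B), y \oc g = 0 -> exists f, g = x \oc f;
  confl_coker : forall (A B D : ec_cat) (x : hom A B) (y : hom B D) d,
    confl x y d ->
    forall (W : ec_cat) (g : hom B W), g \oc x = 0 -> exists f, g = f \oc y;
  confl_lift : forall (A B D : ec_cat) (x : hom A B) (y : hom B D) d,
    confl x y d ->
    forall (W : ec_cat) (c : hom W D), pull d c = 0 -> exists b, c = y \oc b;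
  confl_extend : forall (A B D : ec_cat) (x : hom A B) (y : hom B D) d,
    confl x y d ->
    forall (W : ec_cat) (a : hom A W), push a d = 0 -> exists b, a = b \oc x;
  confl_connl : forall (A B D : ec_cat) (x : hom A B) (y : hom B D) d,
    confl x y d ->
    forall (W : ec_cat) (t : ext W A), push x t = 0 -> exists c, t = pull d c;
  confl_connr : forall (A B D : ec_cat) (x : hom A B) (y : hom B D) d,
    confl x y d ->
    forall (W : ec_cat) (t : ext D W), pull t y = 0 -> exists a, t = push a d;
  confl_base : forall (A B D : ec_cat) (x : hom A B) (y : hom B D) d,
    confl x y d ->
    forall (D' : ec_cat) (c : hom D' D),
      exists (B' : ec_cat) (x' : hom A B') (y' : hom B' D'),
      confl x' y' (pull d c);
  confl_cobase : forall (A B D : ec_cat) (x : hom A B) (y : hom B D) d,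
    confl x y d ->
    forall (A' : ec_cat) (a : hom A A'),
      exists (B' : ec_cat) (x' : hom A' B') (y' : hom B' D),
      confl x' y' (push a d);
  confl_fill : forall (A B B' D : ec_cat) (x : hom A B) (y : hom B D)
      (x' : hom A B') (y' : hom B' D) d,
    confl x y d -> confl x' y' d -> exists b, b \oc x = x' /\ y' \oc b = y;
  confl_1r : forall (A : ec_cat),
    exists (Z : ec_cat), is_null Z /\ confl (0 : hom Z A) (idm A) 0;
  confl_1l : forall (A : ec_cat),
    exists (Z : ec_cat), is_null Z /\ confl (idm A) (0 : hom A Z) 0;
  confl_defl_comp : forall (A B D K P : ec_cat) (x : hom A B) (y : hom B D) d
      (k : hom K P) (p : hom P B) e,
    confl x y d -> confl k p e ->
    exists (H : ec_cat) (h : hom H P) d' (k' : hom K H) (q : hom H A),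
      confl h (y \oc p) d' /\ confl k' q (pull e x);
  confl_infl_comp : forall (A B D J L : ec_cat) (x : hom A B) (y : hom B D) d
      (j : hom B J) (l : hom J L) e,
    confl x y d -> confl j l e ->
    exists (H : ec_cat) (h : hom J H) d' (q : hom D H) (k' : hom H L),
      confl (j \oc x) h d' /\ confl q k' (push y e);
  confl_pullback : forall (A B D K P : ec_cat) (x : hom A B) (y : hom B D) d
      (k : hom K P) (p : hom P D) e,
    confl x y d -> confl k p e ->
    exists (E : ec_cat) (a : hom A E) (b : hom E P) (s : hom K E) (t : hom E B),
      confl a b (pull d p) /\ confl s t (pull e y);
  confl_pushout : forall (A B D J L : ec_cat) (x : hom A B) (y : hom B D) d
      (j : hom A J) (l : hom J L) e,
    confl x y d -> confl j l e ->
    exists (E : ec_cat) (a : hom J E) (b : hom E D) (s : hom B E) (t : hom E L),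
      confl a b (push j d) /\ confl s t (push x e) }.

Arguments ext {_} _ _.
Arguments push {_ _ _ _} _ _.
Arguments pull {_ _ _ _} _ _.
Arguments confl {_ _ _ _} _ _ _.

(** * The opposite extension structure *)

Definition op_cat (C : preaddCat) : preaddCat.
Proof.
refine (@PreaddCat C (fun A B => hom B A) (fun A => idm A)
  (fun A B D (g : hom D B) (f : hom B A) => f \oc g) _ _ _ _ _).
- by move=> A B f; apply: compm1.
- by move=> A B f; apply: comp1m.
- by move=> A B D E h g f; rewrite compA.
- by move=> A B D g g' f; apply: compDr.
- by move=> A B D g f f'; apply: compDl.
Defined.

(** Each axiom is discharged by its dual partner. The definition stays transparent, so that
    projectivity and dimensions in the double opposite convert to those in [E]. *)
Definition op_ext (E : extCat) : extCat.
Proof.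
refine (@ExtCat (op_cat E) (fun D A => @ext E A D)
  (fun A A' D (a : @hom E A' A) d => @pull E _ _ _ d a)
  (fun A D D' d (c : @hom E D D') => @push E _ _ _ c d)
  _ _ _ _ _ _ _ _
  (fun A B D (x : @hom E B A) (y : @hom E D B) d => @confl E D B A y x d)
  _ _ _ _ _ _ _ _ _ _ _ _ _ _ _ _ _ _).
- by move=> A D d; apply: pull1.
- by move=> A D d; apply: push1.
- by move=> A A' A'' D a' a d; apply: pullM.
- by move=> A D D' D'' d c c'; apply: pushM.
- by move=> A A' D d; apply: pull0.
- by move=> A D D' d; apply: push0.
- by move=> A A' D a; apply: pulll0.
- by move=> A D D' c; apply: pushr0.
- by move=> A B D x y d r; apply: (confl_comp r).
- by move=> A B D x y d r; apply: (confl_push r).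
- by move=> A B D x y d r; apply: (confl_pull r).
- by move=> A B D x y d r; apply: (confl_coker r).
- by move=> A B D x y d r; apply: (confl_ker r).
- by move=> A B D x y d r; apply: (confl_extend r).
- by move=> A B D x y d r; apply: (confl_lift r).
- by move=> A B D x y d r; apply: (confl_connr r).
- by move=> A B D x y d r; apply: (confl_connl r).
- move=> A B D x y d r D' c.
  by have [B' [x' [y' r']]] := confl_cobase r c; exists B', y', x'.
- move=> A B D x y d r D' c.
  by have [B' [x' [y' r']]] := confl_base r c; exists B', y', x'.
- move=> A B B' D x y x' y' d r r'.
  by have [b [? ?]] := confl_fill r' r; exists b; split.
- by move=> A; apply: (confl_1l (e0 := E)).
- by move=> A; apply: (confl_1r (e0 := E)).
- move=> A B D K P x y d k p e r r'.
  have [H [h [d' [q [k' [r1 r2]]]]]] := confl_infl_comp r r'.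
  by exists H, h, d', k', q.
- move=> A B D K P x y d k p e r r'.
  have [H [h [d' [q [k' [r1 r2]]]]]] := confl_defl_comp r r'.
  by exists H, h, d', k', q.
- move=> A B D K P x y d k p e r r'.
  have [H [a [b [s [t [r1 r2]]]]]] := confl_pushout r r'.
  by exists H, b, a, t, s.
- move=> A B D K P x y d k p e r r'.
  have [H [a [b [s [t [r1 r2]]]]]] := confl_pullback r r'.
  by exists H, b, a, t, s.
Defined.

(** * Projectives, syzygies and Gorenstein projectives *)

Section Abstract.
Variable E : extCat.

(** Equivalent to lifting along deflations; injectivity of Hom(P, A) -> Hom(P, B) is recovered from
    closure under suspension in [xi_projE]. *)
Definition proj (P : E) : Prop :=
  forall A B D (x : hom A B) (y : hom B D) d, confl x y d ->
  forall p : hom P D, pull d p = 0.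

Definition enough : Prop :=
  forall A : E, exists K P (x : hom K P) (y : hom P A) d, confl x y d /\ proj P.

(** Vanishing of the relative Ext^1: only classes realised by conflations count, not all of
    [ext A B]. *)
Definition ext0 (A B : E) : Prop :=
  forall M (x : hom B M) (y : hom M A) d, confl x y d -> d = 0.

(* [K] is an [n]-th syzygy of [A]; in the opposite category, a cosyzygy. *)
Fixpoint syz (n : nat) (A K : E) : Prop :=
  match n with
  | 0%N => A = K
  | n'.+1 => exists A' P (x : hom A' P) (y : hom P A) d,
      [/\ confl x y d, proj P & syz n' A' K]
  end.

Fixpoint rdim (X : E -> Prop) (n : nat) (A : E) : Prop :=
  match n with
  | 0%N => X A
  | n'.+1 => exists K P (x : hom K P) (y : hom P A) d,
      [/\ confl x y d, X P & rdim X n' K]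
  end.

Definition lperp (A : E) : Prop := forall Q, proj Q -> ext0 A Q.

(* A complete resolution is encoded by a class of objects closed under one step
   in each direction; [lperp] replaces Hom(-, proj)-exactness of the triangles. *)
Definition gproj (G : E) : Prop :=
  exists S : E -> Prop, S G /\ forall B, S B ->
    [/\ lperp B,
        exists K P (x : hom K P) (y : hom P B) d, [/\ confl x y d, proj P & S K]
      & exists P L (x : hom B P) (y : hom P L) d, [/\ confl x y d, proj P & S L]].

Definition retract (A B : E) : Prop :=
  exists (i : hom A B) (r : hom B A), r \oc i = idm A.

End Abstract.

Notation inj := (proj (E := op_ext _)).
Arguments enough : clear implicits.

Section BasicTheory.
Variable E : extCat.
Implicit Types A B D K L P Q : E.

Lemma ext0_op A B : @ext0 (op_ext E) B A <-> ext0 A B.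
Proof. by split=> h M x y d r; apply: (h M y x). Qed.

(** A cobase change of [d] is again realised by a conflation, so the vanishing applies to it. *)
Lemma ext0_push A B K M (x : hom K M) (y : hom M A) d (a : hom K B) :
  ext0 A B -> confl x y d -> push a d = 0.
Proof. by move=> h r; have [B' [x' [y' /h]]] := confl_cobase r a. Qed.

Lemma ext0_pull A B L M (x : hom B M) (y : hom M L) d (c : hom A L) :
  ext0 A B -> confl x y d -> pull d c = 0.
Proof. by move=> h r; have [B' [x' [y' /h]]] := confl_base r c. Qed.

Lemma proj_ext0 P : proj P <-> forall B, ext0 P B.
Proof.
split=> [h B M x y d r|h A B D x y d r p].
  by rewrite -(pull1 d); apply: (h _ _ _ _ _ _ r).
exact: (ext0_pull p (h A) r).
Qed.

End BasicTheory.

(** * Resolutions and closure under retracts *)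

Section Resolutions.
Variable E : extCat.
Implicit Types A B D K L P Q : E.

Lemma inj_ext0 (J : E) : inj J <-> forall A, ext0 A J.
Proof.
rewrite (@proj_ext0 (op_ext E) J).
by split=> h A; apply/ext0_op; apply: h.
Qed.

Lemma ext0_retract A A' B : retract A' A -> ext0 A B -> ext0 A' B.
Proof.
move=> [i [r ri]] h M x y d rd.
by rewrite -(pull1 d) -ri pullM (ext0_pull r h rd) pulll0.
Qed.

Lemma proj_retract P P' : retract P' P -> proj P -> proj P'.
Proof. by move=> h /proj_ext0 hP; apply/proj_ext0 => B; apply: ext0_retract h _. Qed.

Lemma confl_ext0_retract A B D (x : hom A B) (y : hom B D) d :
  confl x y d -> d = 0 -> retract A B /\ retract D B.
Proof.
move=> r d0; rewrite d0 in r; split.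
  by have [b hb] := confl_extend r (pushr0 D (idm A)); exists x, b.
by have [b hb] := confl_lift r (pulll0 A (idm D)); exists b, y.
Qed.

(* Two comparison maps compose to [1 + n] with [n] of square zero. *)
Lemma confl_mid_retract A B B' D (x : hom A B) (y : hom B D) d
    (x' : hom A B') (y' : hom B' D) :
  confl x y d -> confl x' y' d -> retract B B'.
Proof.
move=> r r'.
have [b [bx yb]] := confl_fill r r'; have [c [cx yc]] := confl_fill r' r.
pose n := c \oc b - idm B.
have nx : n \oc x = 0 by rewrite compDl compNl comp1m -compA bx cx subrr.
have yn : y \oc n = 0 by rewrite compDr compNr compm1 compA yc yb subrr.
have [w nw] := confl_coker r nx.
have nn : n \oc n = 0 by rewrite {1}nw -compA yn compm0.
exists b, ((idm B - n) \oc c).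
have cbE : c \oc b = idm B + n by rewrite addrC subrK.
rewrite -compA cbE; clearbody n.
by rewrite compDl !compDr !compNl nn !compm1 comp1m oppr0 addr0 addrK.
Qed.

(** Splits off the last step of a syzygy instead of the first; dimension shifting pairs it with the
    first cosyzygy step of the other argument. *)
Lemma syz_rcons n A K : syz n.+1 A K <->
  exists K' P (x : hom K P) (y : hom P K') d,
    [/\ syz n A K', confl x y d & proj P].
Proof.
elim: n A => [|n IH] A; split.
- by move=> [A' [P [x [y [d [r pP s]]]]]]; exists A, P; rewrite -s; exists x, y, d.
- by move=> [K' [P [x [y [d [s r pP]]]]]]; exists K, P; rewrite [A]s; exists x, y, d.
- move=> [A' [P [x [y [d [r pP /IH[K' [P' [x' [y' [d' [s r' pP']]]]]]]]]]]].
  by exists K', P', x', y', d'; split=> //; exists A', P, x, y, d.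
- move=> [K' [P [x [y [d [[A' [P' [x' [y' [d' [r' pP' s]]]]]] r pP]]]]]].
  exists A', P', x', y', d'; split=> //; apply/IH.
  by exists K', P, x, y, d.
Qed.

Lemma syz_exists : enough E -> forall n A, exists K, syz n A K.
Proof.
move=> en; elim=> [|n IH] A; first by exists A.
have [A' [P [x [y [d [r pP]]]]]] := en A; have [K s] := IH A'.
by exists K, A', P, x, y, d.
Qed.

Lemma rdim_syz n A : rdim (@proj E) n A <-> exists K, syz n A K /\ proj K.
Proof.
elim: n A => [|n IH] A; first by split=> [h|[K [-> ]]]//; exists A.
split=> [[K [P [x [y [d [r pP /IH[K' [s pK']]]]]]]]|[K' [[K [P [x [y [d [r pP s]]]]]] pK']]].
  by exists K'; split=> //; exists K, P, x, y, d.
by exists K, P, x, y, d; split=> //; apply/IH; exists K'.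
Qed.

Lemma rdim_mono (X : E -> Prop) :
  (forall A, X A -> rdim X 1 A) ->
  forall m n A, (m <= n)%N -> rdim X m A -> rdim X n A.
Proof.
move=> X1; have S1 n A : rdim X n A -> rdim X n.+1 A.
  elim: n A => [|n IH] A; first exact: X1.
  by move=> [K [P [x [y [d [r XP /IH h]]]]]]; exists K, P, x, y, d.
by move=> m n A /subnK <-; elim: (n - m)%N => // k IH /IH /S1.
Qed.

Lemma proj_rdim1 : enough E -> forall P, proj P -> rdim (@proj E) 1 P.
Proof.
move=> en P pP; have [K [P' [x [y [d [r pP']]]]]] := en P.
exists K, P', x, y, d; split=> //.
have d0 : d = 0 by rewrite -(pull1 d); apply: (pP _ _ _ _ _ _ r).
exact: proj_retract (confl_ext0_retract r d0).1 pP'.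
Qed.

Lemma null_proj (Z : E) : is_null Z -> proj Z.
Proof. by move=> z A B D x y d r p; rewrite -(compm1 p) z compm0 pull0. Qed.

Lemma proj_gproj : enough E -> forall P, proj P -> gproj P.
Proof.
move=> en P pP; exists (@proj E); split=> // B pB; split.
- by move=> Q _; move: Q; apply/proj_ext0.
- exact: proj_rdim1.
- have [Z [z r]] := confl_1l B.
  by exists B, Z, (idm B), 0, 0; split=> //; apply: null_proj.
Qed.

Lemma gproj_left (G : E) : gproj G ->
  exists K P (x : hom K P) (y : hom P G) d, [/\ confl x y d, proj P & gproj K].
Proof.
move=> [S [SG h]]; have [_ [K [P [x [y [d [r pP SK]]]]]] _] := h _ SG.
by exists K, P, x, y, d; split=> //; exists S.
Qed.

Lemma gproj_right (G : E) : gproj G ->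
  exists P L (x : hom G P) (y : hom P L) d, [/\ confl x y d, proj P & gproj L].
Proof.
move=> [S [SG h]]; have [_ _ [K [P [x [y [d [r pP SK]]]]]]] := h _ SG.
by exists K, P, x, y, d; split=> //; exists S.
Qed.

Lemma gproj_lperp (G : E) : gproj G -> lperp G.
Proof. by move=> [S [SG h]]; have [] := h _ SG. Qed.

Lemma gproj_rdim1 : enough E -> forall G : E, gproj G -> rdim (@gproj E) 1 G.
Proof.
move=> en G /gproj_left[K [P [x [y [d [r pP gK]]]]]].
by exists K, P, x, y, d; split=> //; apply: proj_gproj.
Qed.

Lemma gproj_syz n (G : E) : gproj G -> exists K, syz n G K /\ gproj K.
Proof.
elim: n G => [|n IH] G gG; first by exists G.
have [A [P [x [y [d [r pP /IH[K [s gK]]]]]]]] := gproj_left gG.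
by exists K; split=> //; exists A, P, x, y, d.
Qed.

End Resolutions.

Section Horseshoe.
Variable E : extCat.
Implicit Types A B D K L P Q : E.

(* After pulling back along [PD -> D] the conflation splits; the resolution of
   [A] is transported along the retraction onto [A], and the two deflations
   onto [B] are composed. *)
Lemma horseshoe A B D KA PA KD PD
    (x : hom A B) (y : hom B D) d (ka : hom KA PA) (pa : hom PA A) ea
    (kd : hom KD PD) (pd : hom PD D) ed :
  confl x y d -> confl ka pa ea -> confl kd pd ed -> pull d pd = 0 ->
  exists KB T H,
    [/\ exists (k : hom KB T) (t : hom T B) e, confl k t e,
        retract H PA,
        exists (h : hom H T) (t : hom T PD) e, confl h t e
      & exists (k : hom KA KB) (l : hom KB KD) e, confl k l e].
Proof.
move=> r ra rd d0.
have [F [a [b [s [t [r1 r2]]]]]] := confl_pullback r rd.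
rewrite d0 in r1.
have [u ua] := confl_extend r1 (pushr0 PD (idm A)).
have [T [k [f r3]]] := confl_base ra u.
have [H [h [d1 [k1 [q1 [r4 r5]]]]]] := confl_defl_comp r1 r3.
have [KB [kb [d2 [k2 [q2 [r6 r7]]]]]] := confl_defl_comp r2 r3.
(* As [u] retracts [a], the conflation [KA -> H -> A] has the same class [ea] as the resolution of
   [A], whence [H] is a retract of [PA]. *)
rewrite -pullM -ua pull1 in r5.
exists KB, T, H; split.
- by exists kb, (t \oc f), d2.
- exact: confl_mid_retract r5 ra.
- by exists h, (b \oc f), d1.
- by exists k2, q2, (pull (pull ea u) s).
Qed.

End Horseshoe.

(** * Dimension shifting and bounds on Gorenstein dimensions *)

Section Homological.
Variable E : extCat.
Hypothesis enP : enough E.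
Hypothesis enI : enough (op_ext E).
Implicit Types A B D K L P Q : E.

(** Both sides express Ext^2(A, B) = 0. From left to right, a class of [A] by [L] is [push a d]
    because [P] is projective, [a] lifts along [q] because Ext^1(K, B) = 0, and pushing [d] into the
    injective [J] gives zero. The converse is dual. *)
Lemma ext0_shift K P A (x : hom K P) (y : hom P A) d B J L
    (i : hom B J) (q : hom J L) e :
  confl x y d -> proj P -> confl i q e -> inj J -> (ext0 K B <-> ext0 A L).
Proof.
move=> r pP s iJ; split=> h.
- move=> M x' y' t r'.
  have [a ->] := confl_connr r (pP _ _ _ _ _ _ r' y).
  have [b ->] := confl_lift s (ext0_pull a h s).
  have hb : push b d = 0 := iJ _ _ _ _ _ _ r b.
  by rewrite pushM hb pushr0.
- move=> M x' y' t r'.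
  have [a ->] := confl_connl s (iJ _ _ _ _ _ _ r' i).
  have [b ->] := confl_extend r (ext0_push a h r).
  by rewrite pullM (pP _ _ _ _ _ _ s) pulll0.
Qed.

Lemma ext0_syz n A K B L :
  syz n A K -> @syz (op_ext E) n B L -> (ext0 K B <-> ext0 A L).
Proof.
elim: n A K B L => [|n IH] A K B L; first by move=> /= eA eB; subst K L.
move=> /syz_rcons[K' [P [x [y [d [s r pP]]]]]] [B' [J [i [q [e [r' iJ s']]]]]].
by rewrite (ext0_shift r pP r' iJ); apply: IH.
Qed.

(** The right side mentions no resolution of [A], so the bound can be tested on any syzygy and
    passes to retracts. *)
Lemma pd_leP n A : rdim (@proj E) n A <->
  forall B L, @syz (op_ext E) n B L -> ext0 A L.
Proof.
rewrite rdim_syz; split.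
  move=> [K [s pK]] B L s'; apply/(ext0_syz s s').
  by move/proj_ext0: pK.
move=> h; have [K s] := syz_exists enP n A; exists K; split=> //.
apply/proj_ext0 => B; have [L s'] := syz_exists enI n B.
by apply/(ext0_syz s s'); apply: h s'.
Qed.

Lemma id_leP n B : rdim (@proj (op_ext E)) n B <->
  forall A K, syz n A K -> ext0 K B.
Proof.
rewrite rdim_syz; split.
  move=> [L [s' iL]] A K s; apply/(ext0_syz s s').
  by move/inj_ext0: iL.
move=> h; have [L s'] := syz_exists enI n B; exists L; split=> //.
apply/inj_ext0 => A; have [K s] := syz_exists enP n A.
by apply/(ext0_syz s s'); apply: h s.
Qed.

Lemma pd_syz n A K : rdim (@proj E) n A -> syz n A K -> proj K.
Proof.
move=> /pd_leP h s; apply/proj_ext0 => B; have [L s'] := syz_exists enI n B.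
by apply/(ext0_syz s s'); apply: h s'.
Qed.

Lemma pd_retract n A A' : retract A' A ->
  rdim (@proj E) n A -> rdim (@proj E) n A'.
Proof. by move=> h /pd_leP hA; apply/pd_leP => B L /hA; apply: ext0_retract. Qed.

Lemma pd_mono m n A : (m <= n)%N -> rdim (@proj E) m A -> rdim (@proj E) n A.
Proof. exact/rdim_mono/proj_rdim1. Qed.

Lemma id_mono m n B : (m <= n)%N ->
  rdim (@proj (op_ext E)) m B -> rdim (@proj (op_ext E)) n B.
Proof. exact/rdim_mono/(proj_rdim1 enI). Qed.

(** Moves the vanishing to Hom-groups, where differences can be formed: [push] and [pull] are only
    known to preserve zero. *)
Lemma ext0_lift A B J L (i : hom B J) (q : hom J L) e :
  confl i q e -> inj J ->
  (ext0 A B <-> forall g : hom A L, exists v, g = q \oc v).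
Proof.
move=> r iJ; split=> [h g|h M x y d r'].
  exact: (confl_lift r (ext0_pull g h r)).
have [g ->] := confl_connl r (iJ _ _ _ _ _ _ r' i).
by have [v ->] := h g; rewrite pullM (confl_pull r) pulll0.
Qed.

Lemma ext0_extension A B D Q (x : hom A B) (y : hom B D) d :
  confl x y d -> ext0 A Q -> ext0 D Q -> ext0 B Q.
Proof.
move=> r; have [L [J [i [q [e [s iJ]]]]]] :
    exists L J (i : hom Q J) (q : hom J L) e, confl i q e /\ inj J.
  by have [L [J [q [i [e s]]]]] := enI Q; exists L, J, i, q, e.
rewrite !(ext0_lift _ s iJ) => hA hD g.
have [v gv] := hA (g \oc x).
have [v' vv'] := confl_extend r (iJ _ _ _ _ _ _ r v).
have g0 : (g - (q \oc v')) \oc x = 0.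
  by rewrite compDl compNl -compA -vv' gv subrr.
have [w gw] := confl_coker r g0; have [w' ww'] := hD w.
exists (v' + (w' \oc y)); rewrite compDr compA -ww' -gw.
by rewrite addrC subrK.
Qed.

Lemma proj_extension A B D (x : hom A B) (y : hom B D) d :
  confl x y d -> proj A -> proj D -> proj B.
Proof.
move=> r /proj_ext0 hA /proj_ext0 hD; apply/proj_ext0 => Q.
exact: ext0_extension r (hA Q) (hD Q).
Qed.

Lemma gproj_extension A B D (x : hom A B) (y : hom B D) d :
  confl x y d -> gproj A -> gproj D -> gproj B.
Proof.
move=> r0 gA0 gD0.
(* The witnessing class consists of all extensions of G-projectives by G-projectives; the horseshoe
   lemma and its dual keep it stable in both directions. *)
exists (fun B => exists A D (x : hom A B) (y : hom B D) d,
  [/\ confl x y d, gproj A & gproj D]); split; first by exists A, D, x, y, d.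
move=> {x y d r0 gA0 gD0 A D} {}B [A [D [x [y [d [r gA gD]]]]]]; split.
- move=> Q pQ; exact: ext0_extension r (gproj_lperp gA pQ) (gproj_lperp gD pQ).
- have [KA [PA [ka [pa [ea [ra pPA gKA]]]]]] := gproj_left gA.
  have [KD [PD [kd [pd [ed [rd pPD gKD]]]]]] := gproj_left gD.
  have [KB [T [H [[k [t [e r1]]] rH [h [t' [e' r2]]] [k' [l [e'' r3]]]]]]] :=
    horseshoe r ra rd (pPD _ _ _ _ _ _ r pd).
  exists KB, T, k, t, e; split=> //.
    exact: proj_extension r2 (proj_retract rH pPA) pPD.
  by exists KA, KD, k', l, e''.
(* In the dual horseshoe the splitting condition reads [push ka d = 0]; it holds because [PA] is
   projective and [D] lies in [lperp]. *)
- have [PA [LA [ka [pa [ea [ra pPA gLA]]]]]] := gproj_right gA.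
  have [PD [LD [kd [pd [ed [rd pPD gLD]]]]]] := gproj_right gD.
  have [KB [T [H [[k [t [e r1]]] rH [h [t' [e' r2]]] [k' [l [e'' r3]]]]]]] :=
    @horseshoe (op_ext E) _ _ _ _ _ _ _ _ _ _ _ _ _ _ _ _ r rd ra
      (ext0_push ka (gproj_lperp gD pPA) r).
  exists T, KB, t, k, e; split=> //.
    apply: (proj_extension r2 pPA); apply: proj_retract pPD.
    by have [i [u iu]] := rH; exists u, i.
  by exists LA, LD, l, k', e''.
Qed.

(** Shifting moves the cosyzygies of [Q] to syzygies of [G], which can be chosen G-projective. *)
Lemma gproj_ext0_cosyz n G Q L :
  gproj G -> proj Q -> @syz (op_ext E) n Q L -> ext0 G L.
Proof.
move=> gG pQ s'; have [K [s gK]] := gproj_syz n gG.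
by apply/(ext0_syz s s'); apply: gproj_lperp.
Qed.

(** This is Ext^(n+i+1)(M, Q) = 0. A class on [M] dies on [G], hence comes from a map [K -> L]; by
    induction that map lifts to the injective [J], into which [d] pushes to zero. *)
Lemma gdim_ext0_cosyz n i M Q L :
  rdim (@gproj E) n M -> proj Q -> @syz (op_ext E) (n + i) Q L -> ext0 M L.
Proof.
move=> gM pQ; elim: n M L gM => [|n IH] M L; first by move=> gM; apply: gproj_ext0_cosyz.
move=> [K [G [x [y [d [r gG dK]]]]]] s.
have hG := gproj_ext0_cosyz gG pQ s.
move: s; rewrite addSn => /syz_rcons[L' [J [q [j [e [s r' iJ]]]]]].
have hK := IH _ _ dK s.
move=> N x' y' t rt.
have [u ->] := confl_connr r (ext0_pull y hG rt).
have [v ->] := @confl_lift E L' J L j q e r' K u (ext0_pull u hK r').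
have hv : push v d = 0 := iJ _ _ _ _ _ _ r v.
by rewrite pushM hv pushr0.
Qed.

(* Auslander-Buchweitz approximation. *)
Lemma gdim_approx n M : rdim (@gproj E) n M ->
  exists H G (x : hom M H) (y : hom H G) d,
    [/\ confl x y d, rdim (@proj E) n H & gproj G].
Proof.
elim: n M => [|n IH] M.
  by move=> /gproj_right[P [L [x [y [d [r pP gL]]]]]]; exists P, L, x, y, d.
move=> [K [G0 [x [y [d [r gG dK]]]]]].
have [H' [G' [x' [y' [d' [r' pH gG']]]]]] := IH _ dK.
(* The pushout [F] of [G0] and [H'] under [K] is an extension of G-projectives. It embeds in a
   projective [P], and dividing by [H'] turns [F -> P] into [M -> H] with the same cokernel [G2]. *)
have [F [a [b [s [t [r1 r2]]]]]] := confl_pushout r r'.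
have [P [G2 [j [l [e [r3 pP gG2]]]]]] := gproj_right (gproj_extension r2 gG gG').
have [H [h [d2 [q [k [r4 r5]]]]]] := confl_infl_comp r1 r3.
exists H, G2, q, k, (push b e); split=> //.
by exists H', P, (j \oc a), h, d2.
Qed.

Lemma gdim_silp m : (forall M, rdim (@gproj E) m M) ->
  forall Q, proj Q -> rdim (@proj (op_ext E)) m Q.
Proof.
move=> h Q pQ; apply/rdim_syz; have [L s] := syz_exists enI m Q.
exists L; split=> //; apply/inj_ext0 => A.
by apply: (@gdim_ext0_cosyz m 0 _ _ _ (h A) pQ); rewrite addn0.
Qed.

Lemma gdim_spli m : (forall M, rdim (@gproj E) m M) ->
  forall J : E, inj J -> rdim (@proj E) m J.
Proof.
move=> h J iJ; have [H [G [x [y [d [r pH gG]]]]]] := gdim_approx (h J).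
have d0 : d = 0 by move/inj_ext0: iJ => iJ; apply: iJ r.
exact: pd_retract (confl_ext0_retract r d0).1 pH.
Qed.

(** The syzygy of [A] is prescribed and those of [B] and [D] are constructed, since [gdim_bound]
    starts from an arbitrary syzygy. *)
Lemma horseshoe_syz n A B D KA (x : hom A B) (y : hom B D) d :
  confl x y d -> syz n A KA ->
  exists KB KD (k : hom KA KB) (l : hom KB KD) e,
    [/\ confl k l e, syz n B KB & syz n D KD].
Proof.
elim: n A B D x y d => [|n IH] A B D x y d r.
  by move=> <-; exists B, D, x, y, d.
move=> [A' [PA [ka [pa [ea [ra pPA s]]]]]].
have [D' [PD [kd [pd [ed [rd pPD]]]]]] := enP D.
have [B' [T [H [[k [t [e r1]]] rH [h [t' [e' r2]]] [k' [l [e'' r3]]]]]]] :=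
    horseshoe r ra rd (pPD _ _ _ _ _ _ r pd).
have [KB [KD [k2 [l2 [e2 [r4 sB sD]]]]]] := IH _ _ _ _ _ _ r3 s.
exists KB, KD, k2, l2, e2; split=> //; last by exists D', PD, kd, pd, ed.
exists B', T, k, t, e; split=> //.
exact: proj_extension r2 (proj_retract rH pPA) pPD.
Qed.

Lemma gdim_bound m :
  (forall Q : E, proj Q -> rdim (@proj (op_ext E)) m Q) ->
  (forall J : E, inj J -> rdim (@proj E) m J) ->
  forall M, rdim (@gproj E) m M.
Proof.
move=> silp spli M.
have [K s] := syz_exists enP m M.
suff gK : gproj K.
  elim: m M s {silp spli} => [|n IH] M; first by move=> ->.
  move=> [A [P [x [y [d [r pP /IH h]]]]]].
  by exists A, P, x, y, d; split=> //; apply: proj_gproj.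
(* The class of all [m]-th syzygies, of varying objects, is stable in both directions. *)
exists (fun K => exists M, syz m M K); split; first by exists M.
move=> {M s} {}K [M s]; split.
- by move=> Q /silp/id_leP h; apply: h s.
- have [K' [P [x [y [d [r pP]]]]]] := enP K.
  exists K', P, x, y, d; split=> //.
  (* Read from the front, an (m+1)-st syzygy of [M] is an [m]-th syzygy of its first syzygy. *)
  have : syz m.+1 M K' by apply/syz_rcons; exists K, P, x, y, d.
  by move=> [M' [? [? [? [? [_ _ ?]]]]]]; exists M'.
(* The middle term [KB] is an [m]-th syzygy of an injective, hence projective, and embeds [K] with
   cokernel an [m]-th syzygy of [N]. *)
- have [N [I [q [i [e [r iI]]]]]] := enI M.
  have [KB [KD [k [l [e' [r' sB sD]]]]]] := horseshoe_syz r s.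
  exists KB, KD, k, l, e'; split=> //; last by exists N.
  exact: pd_syz (spli _ iI) sB.
Qed.

(** A bound n+1 with k <= n can be lowered: the (n+1)-st syzygy [K'] is projective, so Ext^(n+1)(A,
    K') = 0, the last conflation [K' -> P -> K] splits and [K] is already projective. *)
Lemma finite_pd_le_silp k :
  (forall Q : E, proj Q -> rdim (@proj (op_ext E)) k Q) ->
  forall n A, rdim (@proj E) n A -> rdim (@proj E) k A.
Proof.
move=> silp; elim=> [|n IH] A; first exact: pd_mono.
case: (leqP n.+1 k) => [nk|kn] hA; first exact: pd_mono hA.
apply: IH; have [K s] := syz_exists enP n A; apply/rdim_syz; exists K; split=> //.
have [K' [P [x [y [d [r pP]]]]]] := enP K.
have pK' : proj K'.
  by apply: pd_syz hA _; apply/syz_rcons; exists K, P, x, y, d.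
have /id_leP h := id_mono (kn : (k <= n)%N) (silp _ pK').
exact: proj_retract (confl_ext0_retract r (h _ _ s _ _ _ _ r)).2 pP.
Qed.

End Homological.

(** * Proper classes of triangles as extension structures *)

Section AddFunctor.
Variables (C D : preaddCat) (F : addFunctor C D).

Lemma fmap0 (A B : C) : fmap F (0 : hom A B) = 0.
Proof. by apply: (addrI (fmap F 0)); rewrite -fmapD !addr0. Qed.

Lemma fmapN (A B : C) (f : hom A B) : fmap F (- f) = - fmap F f.
Proof. by apply: (addrI (fmap F f)); rewrite -fmapD !subrr fmap0. Qed.

End AddFunctor.

Lemma null_zero (C : preaddCat) (Z : C) : is_null Z -> is_zero Z.
Proof.
move=> z X; split=> f; first by rewrite -(compm1 f) z compm0.
by rewrite -(comp1m f) z comp0m.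
Qed.

Lemma null_exists (C : addCat) : exists Z : C, is_null Z.
Proof.
have [Z [i h]] := has_coprod (fun v : void => match v with end : C).
exists Z; have [u [_ uniq]] := h Z (fun v => match v with end).
by rewrite /is_null -(uniq (idm Z)) ?(uniq 0) // => -[].
Qed.

(** * The suspension is fully faithful *)

Section Suspension.
Variable C : suspCat.
Implicit Types A B D : C.

Lemma susp_null (Z : C) : is_null Z -> is_null ('S Z).
Proof. by rewrite /is_null -fmap1 => ->; rewrite fmap0. Qed.

Lemma susp_faithful A B (f g : hom A B) : 'Sm f = 'Sm g -> f = g.
Proof.
have [s [_ s2]] := sv_iso A.
by move=> e; rewrite -[f]compm1 -[g]compm1 -s2 !compA -!sv_nat e.
Qed.

Lemma susp_full A B (c : hom ('S A) ('S B)) : exists f, c = 'Sm f.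
Proof.
have [s [s1 s2]] := sv_iso A.
exists (sv B \oc fmap desusp c \oc s).
(* The triangle identity rewrites the suspended inverse of [sv A] as a component of [su], to which
   naturality applies. *)
have e : su ('S A) = 'Sm s.
  by rewrite -[LHS]comp1m -fmap1 -s1 fmapM -compA su_sv_susp compm1.
by rewrite !fmapM -e -compA -su_nat compA su_sv_susp comp1m.
Qed.

Lemma is_iso_idm A : is_iso (idm A).
Proof. by exists (idm A); rewrite comp1m. Qed.

Lemma is_iso_opp A : is_iso (- idm A).
Proof. by exists (- idm A); rewrite compNl compNr comp1m opprK. Qed.

End Suspension.

(** * Exactness, completion and signs of distinguished triangles *)

Section Triangulated.
Variable C : triangCat.
Implicit Types A B D W : C.

Lemma dist_ker A B D (x : hom A B) (y : hom B D) d : dist (Triangle x y d) ->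
  forall W (g : hom W B), y \oc g = 0 -> exists f, g = x \oc f.
Proof.
move=> /dist_rot r W g yg.
have [Z z] := null_exists C.
(* The rotated triangle on [idm W] maps to the rotated given one, starting with [g]; the third
   component desuspends to the factorisation. *)
have /dist_rot i := dist_id W (null_zero z).
have [|c [_ h]] := dist_fill (a := g) (b := 0) i r; first by rewrite comp0m yg.
have [f cf] := susp_full c; exists f.
apply: susp_faithful; apply: oppr_inj.
by rewrite fmapM -compNl -cf -h fmap1 compNr compm1.
Qed.

Lemma dist_coker A B D (x : hom A B) (y : hom B D) d : dist (Triangle x y d) ->
  forall W (g : hom B W), g \oc x = 0 -> exists f, g = f \oc y.
Proof.
move=> r W g gx.
have [Z z] := null_exists C.
have i : dist (Triangle (0 : hom Z W) (idm W) 0).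
  by apply/dist_rot; rewrite fmap0 oppr0; apply/dist_id/null_zero/susp_null.
have [|c [h _]] := dist_fill (a := 0) (b := g) r i; first by rewrite comp0m gx.
by exists c; rewrite h comp1m.
Qed.

Lemma dist_comp A B D (x : hom A B) (y : hom B D) d :
  dist (Triangle x y d) -> y \oc x = 0.
Proof.
move=> r; have [Z z] := null_exists C.
have [|c [h _]] := dist_fill (a := idm A) (b := x) (dist_id A (null_zero z)) r.
  by rewrite !compm1.
by rewrite -h compm0.
Qed.

Lemma dist_pull A B D (x : hom A B) (y : hom B D) d :
  dist (Triangle x y d) -> d \oc y = 0.
Proof. by move=> /dist_rot/dist_comp. Qed.

Lemma dist_push A B D (x : hom A B) (y : hom B D) d :
  dist (Triangle x y d) -> 'Sm x \oc d = 0.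
Proof.
move=> /dist_rot/dist_pull; rewrite compNl => h.
by apply: oppr_inj; rewrite h oppr0.
Qed.

Lemma dist_lift A B D (x : hom A B) (y : hom B D) d : dist (Triangle x y d) ->
  forall W (c : hom W D), d \oc c = 0 -> exists b, c = y \oc b.
Proof. by move=> /dist_rot/dist_ker. Qed.

Lemma dist_extend A B D (x : hom A B) (y : hom B D) d : dist (Triangle x y d) ->
  forall W (a : hom A W), 'Sm a \oc d = 0 -> exists b, a = b \oc x.
Proof.
move=> /dist_rot/dist_rot/dist_coker h W a /h[f e].
have [b fb] := susp_full f; exists (- b); apply: susp_faithful.
by rewrite fmapM fmapN -fb e compNl compNr.
Qed.

Lemma dist_connl A B D (x : hom A B) (y : hom B D) d : dist (Triangle x y d) ->
  forall W (t : hom W ('S A)), 'Sm x \oc t = 0 -> exists c, t = d \oc c.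
Proof.
move=> /dist_rot/dist_rot/dist_ker h W t e; apply: h.
by rewrite compNl e oppr0.
Qed.

Lemma dist_connr A B D (x : hom A B) (y : hom B D) d : dist (Triangle x y d) ->
  forall W (t : hom D ('S W)), t \oc y = 0 -> exists a, t = 'Sm a \oc d.
Proof.
move=> /dist_rot/dist_coker h W t /h[f ->].
by have [a ->] := susp_full f; exists a.
Qed.

(** The fibre is the desuspended cone, with [su] identifying the cone with a suspension; the sign on
    [x] undoes a rotation. *)
Lemma dist_complete_ty B D (y : hom B D) :
  exists A (x : hom A B) d, dist (Triangle x y d).
Proof.
have [W [m [n r]]] := dist_cone y.
have [s [s1 s2]] := su_iso W.
have [x ex] := susp_full (n \oc s).
exists (desusp W), (- x), (su W \oc m); apply/dist_rot.
apply: (dist_iso r); exists (idm B), (idm D), (su W); split.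
  by split; [exact: is_iso_idm | exact: is_iso_idm | exact: su_iso].
split=> /=; rewrite ?comp1m ?compm1 //.
by rewrite fmapN opprK -ex -compA s1 fmap1 comp1m compm1.
Qed.

Lemma dist_complete_td A D (d : hom D ('S A)) :
  exists B (x : hom A B) (y : hom B D), dist (Triangle x y d).
Proof.
have [B [y [e r]]] := dist_complete_ty d.
have [x ex] := susp_full e.
exists B, (- x), y; apply/dist_rot.
by rewrite fmapN opprK -ex.
Qed.

Lemma dist_neg A B D (x : hom A B) (y : hom B D) d :
  dist (Triangle x y d) -> dist (Triangle (- x) (- y) d).
Proof.
move=> r; apply: (dist_iso r); exists (idm A), (- idm B), (idm D); split.
  by split; [exact: is_iso_idm | exact: is_iso_opp | exact: is_iso_idm].
by split=> /=; rewrite ?fmap1 ?compNl ?compNr ?comp1m ?compm1 ?opprK.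
Qed.

Lemma dist_negr A B D (x : hom A B) (y : hom B D) d :
  dist (Triangle x y d) -> dist (Triangle x (- y) (- d)).
Proof.
move=> r; apply: (dist_iso r); exists (idm A), (idm B), (- idm D); split.
  by split; [exact: is_iso_idm | exact: is_iso_idm | exact: is_iso_opp].
by split=> /=; rewrite ?fmap1 ?compNl ?compNr ?comp1m ?compm1 ?opprK.
Qed.

Lemma dist_rot3 A B D (x : hom A B) (y : hom B D) d :
  dist (Triangle x y d) <-> dist (Triangle (- 'Sm x) (- 'Sm y) (- 'Sm d)).
Proof. by rewrite dist_rot dist_rot dist_rot. Qed.

(** Brings down the suspended triangles produced by the octahedra below: three rotations negate
    every map, and two of the signs can be absorbed. *)
Lemma dist_unsusp A B D (x : hom A B) (y : hom B D) (d : hom D ('S A)) :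
  dist (Triangle ('Sm x) ('Sm y) (- 'Sm d)) -> dist (Triangle x y d).
Proof. by move=> /dist_neg r; apply/dist_rot3. Qed.

End Triangulated.

(** * Stability of a proper class under octahedral constructions *)

Section ProperClassExt.
Variables (C : triangCat) (xi : triangle C -> Prop).
Hypothesis prop : proper_class xi.
Hypothesis enP : enough_proj xi.
Implicit Types A B D W : C.

Lemma xi_proj_pull P : xi_proj xi P ->
  forall A B D (x : hom A B) (y : hom B D) d, xi (Triangle x y d) ->
  forall p : hom P D, d \oc p = 0.
Proof.
move=> pP A B D x y d r p; have [_ _ /(_ p)[b <-]] := pP _ r.
by rewrite compA (dist_pull (proper_dist prop r)) comp0m.
Qed.

(* A connecting map annihilated by all maps from projectives is a cobase change
   of the class of a projective presentation. *)
Lemma xi_detect A B D (x : hom A B) (y : hom B D) d : dist (Triangle x y d) ->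
  (forall P (p : hom P D), xi_proj xi P -> d \oc p = 0) -> xi (Triangle x y d).
Proof.
move=> r h; have [K [P [k [p [e [pP re]]]]]] := enP D.
have [a ea] := dist_connr (proper_dist prop re) (h P p pP).
by rewrite ea in r *; apply: (proper_cobase prop re).
Qed.

Lemma xi_base A B D (x : hom A B) (y : hom B D) d : xi (Triangle x y d) ->
  forall D' (c : hom D' D), exists B' (x' : hom A B') (y' : hom B' D'),
    xi (Triangle x' y' (d \oc c)).
Proof.
move=> r D' c; have [B' [x' [y' r']]] := dist_complete_td (d \oc c).
by exists B', x', y'; apply: (proper_base prop r).
Qed.

Lemma xi_cobase A B D (x : hom A B) (y : hom B D) d : xi (Triangle x y d) ->
  forall A' (a : hom A A'), exists B' (x' : hom A' B') (y' : hom B' D),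
    xi (Triangle x' y' ('Sm a \oc d)).
Proof.
move=> r A' a; have [B' [x' [y' r']]] := dist_complete_td ('Sm a \oc d).
by exists B', x', y'; apply: (proper_cobase prop r).
Qed.

Lemma xi_fill A B B' D (x : hom A B) (y : hom B D)
    (x' : hom A B') (y' : hom B' D) d :
  xi (Triangle x y d) -> xi (Triangle x' y' d) ->
  exists b, b \oc x = x' /\ y' \oc b = y.
Proof.
move=> /(proper_dist prop)/dist_rot/dist_rot r.
move=> /(proper_dist prop)/dist_rot/dist_rot r'.
(* Two rotations put the suspended middle term in third place, where [dist_fill] supplies a map. *)
have [|c [h1 h2]] := dist_fill (a := idm D) (b := idm ('S A)) r r'.
  by rewrite comp1m compm1.
have [b cb] := susp_full c; exists b.
move: h1 h2; rewrite cb compm1 fmap1 comp1m compNr compNl => h1 h2.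
by split; apply/susp_faithful/oppr_inj; rewrite fmapM.
Qed.

Lemma xi_1r A : exists Z, is_null Z /\ xi (Triangle (0 : hom Z A) (idm A) 0).
Proof.
have [Z z] := null_exists C; exists Z; split=> //; apply: (proper_split prop).
by apply/dist_rot; rewrite fmap0 oppr0; apply/dist_id/null_zero/susp_null.
Qed.

Lemma xi_1l A : exists Z, is_null Z /\ xi (Triangle (idm A) (0 : hom A Z) 0).
Proof.
have [Z z] := null_exists C; exists Z; split=> //; apply: (proper_split prop).
exact/dist_id/null_zero.
Qed.

(** Octahedron for [y \oc p], after rotating so that deflations come first. Maps from projectives
    lift along [y], then along [p], so [xi_detect] applies to the composite. *)
Lemma xi_defl_comp A B D K P (x : hom A B) (y : hom B D) d
    (k : hom K P) (p : hom P B) e :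
  xi (Triangle x y d) -> xi (Triangle k p e) ->
  exists H (h : hom H P) d' (k' : hom K H) (q : hom H A),
    xi (Triangle h (y \oc p) d') /\ xi (Triangle k' q (e \oc x)).
Proof.
move=> r r'; have [dr dr'] := (proper_dist prop r, proper_dist prop r').
have [H [h [d' r1]]] := dist_complete_ty (y \oc p).
have [u [v [r2 [ue nu vm lv]]]] :=
  dist_octa ((dist_rot _ _ _).1 dr') ((dist_rot _ _ _).1 dr) ((dist_rot _ _ _).1 r1).
have [k' eu] := susp_full u; have [q ev] := susp_full v.
exists H, h, d', k', q; split.
- apply: xi_detect => // Q w pQ.
  have [w' ww'] := dist_lift dr (xi_proj_pull pQ r w).
  by rewrite ww' compA -ue -compA (xi_proj_pull pQ r') compm0.
- apply: (proper_base prop r'); apply: dist_unsusp.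
  by rewrite -eu -ev fmapM -compNr.
Qed.

Lemma xi_infl_comp A B D J L (x : hom A B) (y : hom B D) d
    (j : hom B J) (l : hom J L) e :
  xi (Triangle x y d) -> xi (Triangle j l e) ->
  exists H (h : hom J H) d' (q : hom D H) (k' : hom H L),
    xi (Triangle (j \oc x) h d') /\ xi (Triangle q k' ('Sm y \oc e)).
Proof.
move=> r r'; have [dr dr'] := (proper_dist prop r, proper_dist prop r').
have [H [h [d' r1]]] := dist_cone (j \oc x).
have [u [v [r2 [ue nu vm lv]]]] := dist_octa dr dr' r1.
exists H, h, d', u, v; split; last exact: (proper_cobase prop r').
apply: xi_detect => // Q w pQ.
(* The octahedron gives ['Sm x \oc d' = e \oc v], which vanishes on projectives, so [d' \oc w]
   factors through [d], and [d] also kills maps from projectives. *)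
have h0 : 'Sm x \oc (d' \oc w) = 0.
  by rewrite compA -lv -compA (xi_proj_pull pQ r').
have [c ->] := dist_connl dr h0.
exact: xi_proj_pull r _.
Qed.

(** The homotopy pullback is the fibre of [e \oc y]; the octahedron for this composite gives its
    triangle over [P]. *)
Lemma xi_pullback A B D K P (x : hom A B) (y : hom B D) d
    (k : hom K P) (p : hom P D) e :
  xi (Triangle x y d) -> xi (Triangle k p e) ->
  exists E (a : hom A E) (b : hom E P) (s : hom K E) (t : hom E B),
    xi (Triangle a b (d \oc p)) /\ xi (Triangle s t (e \oc y)).
Proof.
move=> r r'; have [dr dr'] := (proper_dist prop r, proper_dist prop r').
have [F [s [t r1]]] := dist_complete_td (e \oc y).
have rot2 A' B' D' (x' : hom A' B') (y' : hom B' D') d' :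
  dist (Triangle x' y' d') -> dist (Triangle d' (- 'Sm x') (- 'Sm y')).
  by move=> /dist_rot/dist_rot.
have [u [v [r2 _]]] :=
  dist_octa ((dist_rot _ _ _).1 dr) (rot2 _ _ _ _ _ _ dr') (rot2 _ _ _ _ _ _ r1).
have [a eu] := susp_full u; have [b ev] := susp_full v.
exists F, a, b, s, t; split; last exact: (proper_base prop r').
apply: (proper_base prop r); apply: dist_unsusp.
by rewrite -eu -ev fmapM -compNr.
Qed.

(** The homotopy pushout is read off the octahedron for ['Sm j \oc d]; [r3] places the signs so that
    its first map is ['Sm j] itself. *)
Lemma xi_pushout A B D J L (x : hom A B) (y : hom B D) d
    (j : hom A J) (l : hom J L) e :
  xi (Triangle x y d) -> xi (Triangle j l e) ->
  exists E (a : hom J E) (b : hom E D) (s : hom B E) (t : hom E L),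
    xi (Triangle a b ('Sm j \oc d)) /\ xi (Triangle s t ('Sm x \oc e)).
Proof.
move=> r r'; have [dr dr'] := (proper_dist prop r, proper_dist prop r').
have [F [a [b r1]]] := dist_complete_td ('Sm j \oc d).
have rot2 A' B' D' (x' : hom A' B') (y' : hom B' D') d' :
  dist (Triangle x' y' d') -> dist (Triangle d' (- 'Sm x') (- 'Sm y')).
  by move=> /dist_rot/dist_rot.
have r3 : dist (Triangle ('Sm j) (- 'Sm l) ('Sm e)).
  by have /dist_neg/dist_negr := (dist_rot3 _ _ _).1 dr'; rewrite !opprK.
have [u [v [r2 _]]] := dist_octa (rot2 _ _ _ _ _ _ dr) r3 (rot2 _ _ _ _ _ _ r1).
have [s eu] := susp_full u; have [t ev] := susp_full v.
exists F, a, b, s, t; split; first exact: (proper_cobase prop r).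
apply: (proper_cobase prop r'); apply: dist_unsusp.
by rewrite -eu -ev fmapM -compNl -fmapN.
Qed.

End ProperClassExt.

(** * The extension structure of a proper class *)

Section XiExt.
Variables (C : triangCat) (xi : triangle C -> Prop).
Hypothesis prop : proper_class xi.
Hypothesis enP : enough_proj xi.

Definition xi_ext : extCat.
Proof.
refine (@ExtCat C (fun D A => hom D ('S A))
  (fun A A' D (a : hom A A') (d : hom D ('S A)) => 'Sm a \oc d)
  (fun A D D' (d : hom D ('S A)) (c : hom D' D) => d \oc c)
  _ _ _ _ _ _ _ _
  (fun A B D (x : hom A B) (y : hom B D) d => xi (Triangle x y d))
  _ _ _ _ _ _ _ _ _ (xi_base prop) (xi_cobase prop) (xi_fill prop) (xi_1r prop)
  (xi_1l prop) (xi_defl_comp prop enP) (xi_infl_comp prop enP)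
  (xi_pullback prop) (xi_pushout prop)).
- by move=> A D d; rewrite fmap1 comp1m.
- by move=> A D d; apply: compm1.
- by move=> A A' A'' D a' a d; rewrite fmapM compA.
- by move=> A D D' D'' d c c'; apply: compA.
- by move=> A A' D d; rewrite fmap0 comp0m.
- by move=> A D D' d; apply: compm0.
- by move=> A A' D a; apply: compm0.
- by move=> A D D' c; apply: comp0m.
- by move=> A B D x y d /(proper_dist prop)/dist_comp.
- by move=> A B D x y d /(proper_dist prop)/dist_pull.
- by move=> A B D x y d /(proper_dist prop)/dist_push.
- by move=> A B D x y d /(proper_dist prop)/dist_ker.
- by move=> A B D x y d /(proper_dist prop)/dist_coker.
- by move=> A B D x y d /(proper_dist prop)/dist_lift.
- by move=> A B D x y d /(proper_dist prop)/dist_extend.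
- by move=> A B D x y d /(proper_dist prop)/dist_connl.
- by move=> A B D x y d /(proper_dist prop)/dist_connr.
Defined.

End XiExt.

Lemma iso_eq0l (C : preaddCat) (A B D : C) (s : hom B D) (f : hom A B) :
  is_iso s -> s \oc f = 0 -> f = 0.
Proof. by move=> [t [ts _]] sf; rewrite -(comp1m f) -ts -compA sf compm0. Qed.

Lemma iso_eq0r (C : preaddCat) (A B D : C) (s : hom A B) (f : hom B D) :
  is_iso s -> f \oc s = 0 -> f = 0.
Proof. by move=> [t [_ st]] fs; rewrite -(compm1 f) -st compA fs comp0m. Qed.

Lemma comp_injl (C : preaddCat) (A B D : C) (x : hom B D) :
  (forall f : hom A B, x \oc f = 0 -> f = 0) -> injective (fun f : hom A B => x \oc f).
Proof.
move=> h f g /= e; apply/subr0_eq/h.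
by rewrite compDr compNr e subrr.
Qed.

Lemma comp_injr (C : preaddCat) (A B D : C) (x : hom A B) :
  (forall f : hom B D, f \oc x = 0 -> f = 0) -> injective (fun f : hom B D => f \oc x).
Proof.
move=> h f g /= e; apply/subr0_eq/h.
by rewrite compDl compNl e subrr.
Qed.

(** * Comparison of the relative notions with the abstract ones *)

Section SuspendedClass.
Variables (C : triangCat) (xi : triangle C -> Prop).
Hypothesis prop : proper_class xi.
Hypothesis enP : enough_proj xi.
Hypothesis xi_susp : closed_susp xi.
Let E := xi_ext prop enP.

Lemma xi_susp1 (A B D : C) (x : hom A B) (y : hom B D) d : xi (Triangle x y d) ->
  exists (x1 : hom ('S A) ('S B)) (y1 : hom ('S B) ('S D)),
    xi (Triangle x1 y1 (- 'Sm d)).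
Proof.
move/(@xi_susp 1); rewrite /triangle_susp /= fmap1 comp1m.
by rewrite [(-1) ^ _]expr1z !mulrN1z => h; eexists; eexists; exact: h.
Qed.

Lemma xi_suspN1 (A B D : C) (x : hom A B) (y : hom B D) d : xi (Triangle x y d) ->
  exists (x1 : hom (desusp A) (desusp B)) (y1 : hom (desusp B) (desusp D)),
    xi (Triangle x1 y1 (- (su A \oc sv A \oc fmap desusp d))).
Proof.
move/(@xi_susp (Negz 0)); rewrite /triangle_susp /= fmap1 compm1.
have -> : (-1 : int) ^ (Negz 0) = -1 by [].
by rewrite !mulrN1z => h; eexists; eexists; exact: h.
Qed.

Lemma xi_projE : xi_proj xi = proj (E := E).
Proof.
apply/funext => P; apply/propext; split=> [pP|pP [A B D x y d] r].
  by move=> A B D x y d r p; apply: (xi_proj_pull prop pP r).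
have dr := proper_dist prop r; split=> /=.
(* The suspension of [g] factors as [d \oc h]. Desuspending [h] gives a map from [P] to the end of
   the desuspended triangle, whose class it must kill; hence [g = 0]. *)
- apply: comp_injl => g xg.
  have [h gh] : exists h, 'Sm g = d \oc h.
    by apply: (dist_connl dr); rewrite -fmapM xg fmap0.
  have [x1 [y1 r1]] := xi_suspN1 r.
  have [s [_ vs]] := sv_iso P.
  have := pP _ _ _ _ _ _ r1 (fmap desusp h \oc s).
  rewrite /= compNl -!compA [fmap desusp d \oc _]compA -fmapM -gh.
  rewrite [sv A \oc _]compA sv_nat -compA vs compm1 => /eqP.
  by rewrite oppr_eq0 => /eqP; apply: iso_eq0l; apply: su_iso.
- move=> f; split=> [/(dist_ker dr)[g ->]|[g <-]]; first by exists g.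
  by rewrite compA (dist_comp dr) comp0m.
- by move=> f; have [b ->] := dist_lift dr (pP _ _ _ _ _ _ r f); exists b.
Qed.

Lemma xi_injE : xi_inj xi = proj (E := op_ext E).
Proof.
apply/funext => J; apply/propext; split=> [iJ|iJ [A B D x y d] r].
  move=> D B A y x d r a /=.
  have [_ _ /(_ a)[b <-]] := iJ _ r.
  by rewrite fmapM -compA (dist_push (proper_dist prop r)) compm0.
have dr := proper_dist prop r; split=> /=.
(* Dually, [g = f \oc d], and [f] pushes the class of the suspended triangle to zero. *)
- apply: comp_injr => g /(dist_coker ((dist_rot _ _ _).1 dr))[f ->].
  have [x1 [y1 r1]] := xi_susp1 r.
  have /eqP := iJ _ _ _ _ _ _ r1 f.
  rewrite /= compNr -fmapM oppr_eq0 => /eqP e.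
  by apply: susp_faithful; rewrite e fmap0.
- move=> f; split=> [/(dist_coker dr)[g ->]|[g <-]]; first by exists g.
  by rewrite -compA (dist_comp dr) compm0.
- move=> f; have [b ->] := dist_extend dr (iJ _ _ _ _ _ _ r f).
  by exists b.
Qed.

(** A class on [desusp P] is tested after suspension, as the pullback to [P] of a suspended
    triangle. *)
Lemma proj_desusp (P : E) : proj P -> proj (desusp P : E).
Proof.
move=> pP A B D x y d r p /=.
have [x1 [y1 r1]] := xi_susp1 r.
have /eqP := pP _ _ _ _ _ _ r1 ('Sm p \oc su P).
rewrite /= compNl compA -fmapM oppr_eq0 => /eqP/(iso_eq0r (su_iso P)) e.
by apply: susp_faithful; rewrite e fmap0.
Qed.

Lemma inj_susp (J : E) : inj J -> inj ('S J : E).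
Proof.
move=> iJ D B A y x d r a /=.
have [x1 [y1 r1]] := xi_suspN1 r.
have /eqP := iJ _ _ _ _ _ _ r1 (sv J \oc fmap desusp a).
rewrite /= compNr oppr_eq0 !fmapM => /eqP.
rewrite -!compA ['Sm (fmap desusp a) \oc _]compA -su_nat !compA su_sv_susp comp1m.
rewrite -sv_nat -compA -fmapM => e.
apply: (iso_eq0l (su_iso _)); rewrite su_nat.
by rewrite (iso_eq0l (sv_iso _) e) fmap0 comp0m.
Qed.

(* Injectivity of [Hom(D, W) -> Hom(B, W)] follows from surjectivity of
   [Hom(B, desusp W) -> Hom(A, desusp W)]. *)
Lemma hom_to_exactP (A B D W : C) (x : hom A B) (y : hom B D) d :
  xi (Triangle x y d) -> (forall Q : E, proj Q -> ext0 (D : E) Q) -> proj (W : E) ->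
  hom_to_exact (Triangle x y d) W.
Proof.
move=> r h pW; have dr := proper_dist prop r; split=> /=.
- apply: comp_injr => g /(dist_coker ((dist_rot _ _ _).1 dr))[u ->].
  have [v ev] := susp_full (su W \oc u).
  apply: (iso_eq0l (su_iso W)); rewrite compA ev.
  exact: (@ext0_push E _ _ _ _ _ _ _ v (h _ (proj_desusp pW)) r).
- move=> f; split=> [/(dist_coker dr)[g ->]|[g <-]]; first by exists g.
  by rewrite -compA (dist_comp dr) compm0.
- move=> f; have [|b ->] := dist_extend dr (a := f); last by exists b.
  exact: (@ext0_push E _ _ _ _ _ _ _ f (h _ pW) r).
Qed.

(** If [x] kills [g], then ['Sm g] is the pullback of [d] to ['S W], which is again injective, so it
    vanishes. *)
Lemma hom_from_exactP (A B D W : C) (x : hom A B) (y : hom B D) d :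
  xi (Triangle x y d) -> (forall J : E, inj J -> ext0 (J : E) A) -> inj (W : E) ->
  hom_from_exact W (Triangle x y d).
Proof.
move=> r h iW; have dr := proper_dist prop r; split=> /=.
- apply: comp_injl => g xg; apply: susp_faithful; rewrite fmap0.
  have [|c ->] := dist_connl dr (t := 'Sm g); first by rewrite -fmapM xg fmap0.
  exact: (@ext0_pull E _ _ _ _ _ _ _ c (h _ (inj_susp iW)) r).
- move=> f; split=> [/(dist_ker dr)[g ->]|[g <-]]; first by exists g.
  by rewrite compA (dist_comp dr) comp0m.
- move=> f; have [|b ->] := dist_lift dr (c := f); last by exists b.
  exact: (@ext0_pull E _ _ _ _ _ _ _ f (h _ iW) r).
Qed.

(** Given [S], a step in each direction is chosen inside it, and iterating both from [A] yields a
    resolution indexed by the integers. *)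
Lemma complete_resolutionP (X : C -> Prop) (Ec : triangle C -> Prop) (A : C) :
  (exists (R : complete_resolution xi X Ec) (n : int), A = cK R n) <->
  exists S : C -> Prop, S A /\ forall B, S B ->
    (exists K P (x : hom K P) (y : hom P B) d,
       [/\ xi (Triangle x y d), X P, Ec (Triangle x y d) & S K]) /\
    (exists P L (x : hom B P) (y : hom P L) d,
       [/\ xi (Triangle x y d), X P, Ec (Triangle x y d) & S L]).
Proof.
split=> [[R [n ->]]|[S [SA h]]].
  exists (fun B => exists n, B = cK R n); split; first by exists n.
  move=> B [m ->]; split.
    exists (cK R (m + 1)), (cP R m), (cg R m), (cf R m), (ch R m); split.
    - exact: c_xi.
    - exact: cP_in.
    - exact: c_exact.
    - by exists (m + 1).
  (* Stated at index [m - 1 + 1], so that rewriting the whole existential avoids casting maps. *)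
  have : exists P L (x : hom (cK R (m - 1 + 1)) P) (y : hom P L) d,
       [/\ xi (Triangle x y d), X P, Ec (Triangle x y d) & exists n, L = cK R n].
    exists (cP R (m - 1)), (cK R (m - 1)), (cg R (m - 1)), (cf R (m - 1)), (ch R (m - 1)).
    split; [exact: c_xi | exact: cP_in | exact: c_exact | by exists (m - 1)].
  by rewrite subrK.
pose T := {B | S B}.
pose step (K B : C) := exists P (x : hom K P) (y : hom P B) d,
  [/\ xi (Triangle x y d), X P & Ec (Triangle x y d)].
have /choice[l lP] (b : T) : exists b' : T, step (sval b') (sval b).
  case: b => B SB.
  have [[K [P [x [y [d [r XP e SK]]]]]] _] := h B SB.
  by exists (exist S K SK); exists P, x, y, d.
have /choice[u uP] (b : T) : exists b' : T, step (sval b) (sval b').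
  case: b => B SB.
  have [_ [P [L [x [y [d [r XP e SL]]]]]]] := h B SB.
  by exists (exist S L SL); exists P, x, y, d.
pose a : T := exist S A SA.
(* [Negz m] is -(m+1), hence the [m.+1] upward steps; [A] sits at index 0. *)
pose K (n : int) : C :=
  sval (match n with Posz m => iter m l a | Negz m => iter m.+1 u a end).
have KP n : step (K (n + 1)) (K n).
  case: n => [n|[|n]].
  - by rewrite -PoszD addn1; apply: lP.
  - exact: (uP a).
  - have -> : Negz n.+1 + 1 = Negz n by rewrite !NegzE -addn1 PoszD opprD addrNK.
    exact: uP.
pose P n := sval (cid (KP n)).
pose g n := sval (cid (svalP (cid (KP n)))).
pose f n := sval (cid (svalP (cid (svalP (cid (KP n)))))).
pose k n := sval (cid (svalP (cid (svalP (cid (svalP (cid (KP n)))))))).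
have R n : [/\ xi (Triangle (g n) (f n) (k n)), X (P n) & Ec (Triangle (g n) (f n) (k n))].
  exact: svalP (cid (svalP (cid (svalP (cid (svalP (cid (KP n)))))))).
by exists (@CompleteRes _ _ _ _ P K g f k (fun n => g n \oc f (n + 1))
  (fun n => let: And3 _ p _ := R n in p) (fun n => let: And3 p _ _ := R n in p)
  (fun n => let: And3 _ _ p := R n in p) (fun n => erefl)), 0.
Qed.

Lemma xi_GprojE : xi_Gproj xi = gproj (E := E).
Proof.
apply/funext => A; apply/propext; rewrite /xi_Gproj complete_resolutionP xi_projE.
split=> -[S [SA h]]; exists S; split=> // B SB; have := h B SB.
- move=> [[K [P [x [y [d [r pP ex SK]]]]]] [P' [L [x' [y' [d' [r' pP' _ SL]]]]]]].
  split; [|by exists K, P, x, y, d|by exists P', L, x', y', d'].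
  (* The class [t] dies on the projective [P], so it is [push c d]; by exactness [c] extends along
     [x], and [x] pushes [d] to zero. *)
  move=> Q pQ M a b t rt.
  have [c ->] := @confl_connr E _ _ _ _ _ _ r _ t (pP _ _ _ _ _ _ rt y).
  have [_ _ /(_ c)[e <-]] := ex Q pQ.
  by rewrite pushM (@confl_push E _ _ _ _ _ _ r) pushr0.
- move=> [hB [K [P [x [y [d [r pP SK]]]]]] [P' [L [x' [y' [d' [r' pP' SL]]]]]]].
  (* Exactness of a triangle needs Ext^1 vanishing at its third vertex: [B] for the first, [L] for
     the second. *)
  have [hL _ _] := h L SL.
  split; [exists K, P, x, y, d|exists P', L, x', y', d']; split=> // W pW.
    exact: hom_to_exactP r hB pW.
  exact: hom_to_exactP r' hL pW.
Qed.

Lemma xi_GinjE : xi_Ginj xi = gproj (E := op_ext E).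
Proof.
apply/funext => A; apply/propext; rewrite /xi_Ginj complete_resolutionP xi_injE.
split=> -[S [SA h]]; exists S; split=> // B SB; have := h B SB.
- move=> [[K [P [x [y [d [r pP ex SK]]]]]] [P' [L [x' [y' [d' [r' pP' ex' SL]]]]]]].
  split; [|by exists L, P', y', x', d'|by exists P, K, y, x, d].
  move=> Q pQ; apply/ext0_op => M a b t rt.
  have [c ->] := @confl_connl E _ _ _ _ _ _ r' _ t (pP' _ _ _ _ _ _ rt x').
  have [_ _ /(_ c)[e <-]] := ex' Q pQ.
  by rewrite pullM (@confl_pull E _ _ _ _ _ _ r') pulll0.
- move=> [hB [K [P [x [y [d [r pP SK]]]]]] [P' [L [x' [y' [d' [r' pP' SL]]]]]]].
  have [hK _ _] := h K SK; have [hL _ _] := h L SL.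
  split; [exists L, P', y', x', d'|exists P, K, y, x, d]; split=> // W pW.
    by apply: hom_from_exactP r' _ pW => J iJ; apply/ext0_op/hL.
  by apply: hom_from_exactP r _ pW => J iJ; apply/ext0_op/hB.
Qed.

Lemma coresdimE (X : C -> Prop) n A :
  coresdim_le xi X n A = rdim (E := op_ext E) X n A.
Proof.
apply/propext; elim: n A => [|n IH] A //=; split.
  by move=> [J [K [x [y [d [r XJ /IH h]]]]]]; exists K, J, y, x, d.
by move=> [J [K [x [y [d [r XJ /IH h]]]]]]; exists K, J, y, x, d.
Qed.

End SuspendedClass.

(** * Bounds on suprema and the final equivalences *)

Lemma enat_le_least (Q : nat -> Prop) m :
  (forall i j, (i <= j)%N -> Q i -> Q j) -> enat_le (least Q) (Some m) <-> Q m.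
Proof.
move=> mono; rewrite /least; case: pselect => [ex|nex] /=.
  case: ex_minnP => i /asboolP Qi min; split=> [im|Qm]; first exact: mono Qi.
  by apply: min; apply/asboolP.
by split=> // Qm; case: nex; exists m; apply/asboolP.
Qed.

Lemma enat_le_trans u v w : enat_le u v -> enat_le v w -> enat_le u w.
Proof. by case: u v w => [a|] [b|] [c|] //=; apply: leq_trans. Qed.

Lemma enat_le_sup (U : enat -> Prop) m :
  enat_le (enat_sup U) (Some m) <-> forall u, U u -> enat_le u (Some m).
Proof.
apply: enat_le_least => i j ij h u /h; move/enat_le_trans; exact.
Qed.

Lemma enat_sup_least (T : Type) (X : T -> Prop) (Q : nat -> T -> Prop) (U : enat -> Prop) m :
  (forall A i j, (i <= j)%N -> Q i A -> Q j A) ->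
  (forall u, U u <-> exists A, X A /\ u = least (fun n => Q n A)) ->
  enat_le (enat_sup U) (Some m) <-> forall A, X A -> Q m A.
Proof.
move=> mono UE; rewrite enat_le_sup; split=> [h A XA|h u /UE[A [XA ->]]].
  by apply/(enat_le_least _ (mono A))/h/UE; exists A.
exact/(enat_le_least _ (mono A))/h.
Qed.

Lemma enat_eq u v :
  (forall m, enat_le u (Some m) <-> enat_le v (Some m)) -> u = v.
Proof.
case: u v => [a|] [b|] //= h.
- by congr Some; apply/eqP; rewrite eqn_leq (h b).2 ?(h a).1.
- by have := (h a).1 (leqnn a).
- by have := (h b).2 (leqnn b).
Qed.

Theorem corollary4p12 (C : triangCat) (xi : triangle C -> Prop)
    (xi_proper : proper_class xi) (xi_susp : closed_susp xi)
    (xi_enough_proj : enough_proj xi) (xi_enough_inj : enough_inj xi)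
    (gen : generating (xi_proj xi)) (cogen : cogenerating (xi_inj xi)) :
  (forall m : nat,
     (enat_le (sup_Gpd xi) (Some m) <-> enat_le (sup_Gid xi) (Some m)) /\
     (enat_le (sup_Gid xi) (Some m) <->
        xi_spli xi = xi_silp xi /\ enat_le (xi_silp xi) (Some m))) /\
  sup_Gpd xi = sup_Gid xi.
Proof.
pose E := xi_ext xi_proper xi_enough_proj.
have enP : enough E.
  move=> A; have [K [P [x [y [d [pP r]]]]]] := xi_enough_proj A.
  by exists K, P, x, y, d; split=> //; rewrite -(xi_projE _ _ xi_susp).
have enI : enough (op_ext E).
  move=> A; have [J [K [x [y [d [iJ r]]]]]] := xi_enough_inj A.
  by exists K, J, y, x, d; split=> //; rewrite -(xi_injE _ _ xi_susp).
have xiG := xi_GprojE xi_proper xi_enough_proj xi_susp.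
have xiGi := xi_GinjE xi_proper xi_enough_proj xi_susp.
have xiP := xi_projE xi_proper xi_enough_proj xi_susp.
have xiI := xi_injE xi_proper xi_enough_proj xi_susp.
have GpdP m : enat_le (sup_Gpd xi) (Some m) <-> forall M : E, rdim (@gproj E) m M.
  rewrite (@enat_sup_least C (fun=> True) (rdim (@gproj E))).
  - by split=> h A *; apply: h.
  - by move=> A i j; apply/rdim_mono/(gproj_rdim1 enP).
  - by move=> u; rewrite /xi_Gpd xiG; split=> [[A]|[A []]]; exists A.
have GidP m : enat_le (sup_Gid xi) (Some m) <->
    forall M : op_ext E, rdim (@gproj (op_ext E)) m M.
  rewrite (@enat_sup_least C (fun=> True) (rdim (@gproj (op_ext E)))).
  - by split=> h A *; apply: h.
  - by move=> A i j; apply/rdim_mono/(gproj_rdim1 enI).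
  - move=> u; rewrite /xi_Gid xiGi; split=> [[A e]|[A [_ e]]]; exists A.
      by split=> //; rewrite e; congr least; apply/funext => n; apply: coresdimE.
    rewrite e; congr least; apply/funext => n.
    by rewrite (coresdimE xi_proper xi_enough_proj).
have silpP m : enat_le (xi_silp xi) (Some m) <->
    forall Q : E, proj Q -> rdim (@proj (op_ext E)) m Q.
  apply: enat_sup_least => [A i j|u]; first exact/rdim_mono/(proj_rdim1 enI).
  rewrite xiP /xi_id xiI; split=> -[A [pA e]]; exists A; split=> //; rewrite e.
    by congr least; apply/funext => n; apply: coresdimE.
  by congr least; apply/funext => n; rewrite (coresdimE xi_proper xi_enough_proj).
have spliP m : enat_le (xi_spli xi) (Some m) <->
    forall J : E, inj J -> rdim (@proj E) m J.
  apply: enat_sup_least => [A i j|u]; first exact/rdim_mono/(proj_rdim1 enP).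
  by rewrite xiI /xi_pd xiP.
(* This condition is self-dual, since passing to the opposite exchanges its two halves; both global
   dimensions are compared with it. *)
pose bnd m := enat_le (xi_silp xi) (Some m) /\ enat_le (xi_spli xi) (Some m).
have G1 m : enat_le (sup_Gpd xi) (Some m) <-> bnd m.
  rewrite /bnd GpdP silpP spliP; split=> [h|[h1 h2]]; last exact: gdim_bound.
  by split; [exact: gdim_silp | exact: gdim_spli].
have G2 m : enat_le (sup_Gid xi) (Some m) <-> bnd m.
  rewrite /bnd GidP silpP spliP; split=> [h|[h1 h2]].
    split; first exact: (@gdim_spli (op_ext E) enI enP m h).
    exact: (@gdim_silp (op_ext E) enP m h).
  exact: (@gdim_bound (op_ext E) enI enP m h2 h1).
have G12 m : enat_le (sup_Gpd xi) (Some m) <-> enat_le (sup_Gid xi) (Some m).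
  by rewrite G1 G2.
split; last exact: enat_eq.
move=> m; split=> //; rewrite G2 /bnd; split=> [[h1 h2]|[-> h]] //; split=> //.
(* The bound [m] only serves to make the dimensions finite; [finite_pd_le_silp] and its dual then
   transfer every bound [k] between the two invariants. *)
apply: enat_eq => k; move: h1 h2; rewrite !silpP !spliP => h1 h2.
split=> h A hA.
  exact: (@finite_pd_le_silp (op_ext E) enI enP k h m A (h1 A hA)).
exact: (finite_pd_le_silp enP enI h (h2 A hA)).
Qed.
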